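(* Let $X=\{X_n,\ n\in\mathbb{Z}\}$ be a zero-mean ARH(1) process with values in a real separable Hilbert space $H$, with autocorrelation operator $\rho$, satisfying Assumptions A1, A2, A3 and A4 given in the context, and let $\widehat{\rho}_{k_n}$ be the truncated componentwise estimator of $\rho$ defined in the context. Then, as $n\to\infty$, $$\left\|\rho-\widehat\rho_{k_n}\right\|_{\mathcal{S}(H)}\to 0\quad\text{in probability}.$$
   Context: $H$ is a real separable Hilbert space and $(\Omega,\mathcal{A},\mathcal{P})$ the underlying probability space. $\mathcal{L}(H)$ is the space of bounded linear operators on $H$ and $\mathcal{S}(H)$ the Hilbert space of Hilbert--Schmidt operators on $H$. For $x,y\in H$, $x\otimes y$ is the rank-one operator; in particular $(\phi\otimes\phi)(x)=\langle\phi,x\rangle_H\phi$. ARH(1) process: $X_n=\rho(X_{n-1})+\varepsilon_n$ for all $n\in\mathbb{Z}$, where $\rho\in\mathcal{L}(H)$ with $\|\rho\|_{\mathcal{L}(H)}<1$, and $\varepsilon=\{\varepsilon_n,\ n\in\mathbb{Z}\}$ is an $H$-valued strong white noise: the $\varepsilon_n$ are independent and identically distributed, zero-mean, with $\mathrm{E}\{\|\varepsilon_n\|_H^2\}=\sigma_\varepsilon^2<\infty$. $X$ is the stationary solution $X_n=\sum_{k\ge 0}\rho^k(\varepsilon_{n-k})$. Assumption A1: the autocovariance operator $C=\mathrm{E}\{X_n\otimes X_n\}=\mathrm{E}\{X_0\otimes X_0\}$ is positive, self-adjoint and trace class, with $C=\sum_{j=1}^\infty C_j\,\phi_j\otimes\phi_j$,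 where $\{\phi_j,\ j\ge1\}$ is an orthonormal system of (known) eigenvectors, $C_1\ge C_2\ge\dots\ge C_j\ge\dots>0$ and $\sum_{j=1}^\infty C_j<\infty$. Assumption A2: $\rho$ is self-adjoint and Hilbert--Schmidt, with $\rho=\sum_{j=1}^\infty\rho_j\,\phi_j\otimes\phi_j$ and $\sum_{j=1}^\infty\rho_j^2<\infty$, for the same system $\{\phi_j\}$; thus $\|\rho\|_{\mathcal{L}(H)}=\sup_{j\ge1}|\rho_j|<1$. Notation: $X_{n,j}=\langle X_n,\phi_j\rangle_H$, $\varepsilon_{n,j}=\langle\varepsilon_n,\phi_j\rangle_H$, $\sigma_j^2=C_j(1-\rho_j^2)=\mathrm{E}\{\varepsilon_{n,j}^2\}$, $\eta_j(n)=X_{n,j}/\sqrt{C_j}$, $\widetilde\eta_j(n)=\varepsilon_{n,j}/\sigma_j$. It is assumed throughout that $\mathrm{E}\{\widetilde\eta_j(n)^4\}<\infty$ for each $j\ge1$ and $n\in\mathbb{Z}$. Estimator: for a sample $X_0,\dots,X_{n-1}$ of size $n\ge2$, $$\widehat D_{n,j}=\frac{1}{n-1}\sum_{i=0}^{n-2}X_{i,j}X_{i+1,j},\quad \widehat C_{n,j}=\frac1n\sum_{i=0}^{n-1}X_{i,j}^2,\quad \widehat\rho_{n,j}=\frac{\widehat D_{n,j}}{\widehat C_{n,j}},\quad \widehat\rho_{k_n}=\sum_{j=1}^{k_n}\widehat\rho_{n,j}\,\phi_j\otimes\phi_j,$$ with the convention $0/0=0$, where $k_n$ are positive integers with $\lim_{n\to\infty}k_n=\infty$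 and $k_n/n<1$ for $n\ge2$. Assumption A3: $\lim_{n\to\infty}C_{k_n}\sqrt n=\infty$. Assumption A4: for each $j\ge1$, let $\widetilde K_{j,1},\widetilde K_{j,2}$ be positive constants such that, for $n$ sufficiently large, $$\mathrm{E}\Big\{\Big(1-\frac1n\sum_{i=0}^{n-1}\eta_j^2(i)\Big)^2\Big\}\le\frac{\widetilde K_{j,1}}{n},\qquad \mathrm{E}\Big\{\Big(\rho_j-\frac1{n-1}\sum_{i=0}^{n-2}\eta_j(i)\eta_j(i+1)\Big)^2\Big\}\le\frac{\widetilde K_{j,2}}{n}.$$ It is assumed that $S=\sup_{j\ge1}(\widetilde K_{j,1}+\widetilde K_{j,2})<\infty$. *)

(* Defs.v *)
From HB Require Import structures.
From mathcomp Require Import all_boot all_order all_algebra.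
From mathcomp Require Import finmap.
From mathcomp Require Import all_classical all_reals all_analysis.

Set Implicit Arguments.
Unset Strict Implicit.
Unset Printing Implicit Defensive.

Import Order.TTheory GRing.Theory Num.Theory.
Import numFieldNormedType.Exports.

Local Open Scope classical_set_scope.
Local Open Scope ring_scope.

Definition separable (T : topologicalType) :=
  exists2 D : set T, countable D & dense D.

Definition borel (T : ptopologicalType) := g_sigma_algebraType (@open T).

(** A real Hilbert space is a complete normed module [H] with a dot product
    [ip] inducing its norm. *)
Definition induces_norm (R : realType) (H : normedModType R)
    (ip : {dot H for idfun}) :=
  forall x : H, `|x| ^+ 2 = ip x x.

Section operators.
Context (R : realType) (H : normedModType R) (ip : {dot H for idfun}).
Implicit Types (f : H -> H) (e phi : nat -> H).

Definition tensor (x y : H) : H -> H := fun z => ip x z *: y.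

Definition opnorm f : \bar R :=
  ereal_sup [set (`|f x|)%:E | x in [set x : H | `|x| <= 1]].

Definition self_adjoint f := forall x y : H, ip (f x) y = ip x (f y).

Definition positive_op f := forall x : H, 0 <= ip (f x) x.

(** Not assumed complete. *)
Definition orthonormal_system phi :=
  forall i j, ip (phi i) (phi j) = (i == j)%:R.

Definition orthonormal_basis e :=
  orthonormal_system e /\
  forall x : H, (fun n => \sum_(k < n) ip (e k) x *: e k) @ \oo --> x.

(** The Hilbert-Schmidt norm computed in [e]; when [e] is an orthonormal basis
    the value does not depend on [e]. *)
Definition hs_norm e f : \bar R :=
  ((\sum_(0 <= k <oo) (`|f (e k)| ^+ 2)%:E) `^ 2^-1)%E.

(** Meaningful for positive [f] (all terms are then nonnegative); such an [f]
    is trace class iff this value is finite. *)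
Definition trace e f : \bar R := (\sum_(0 <= k <oo) (ip (f (e k)) (e k))%:E)%E.

(** [f = \sum_j a_j (phi_j (x) phi_j)], the series converging pointwise. *)
Definition diagonal_in phi (a : nat -> R) f :=
  forall x : H,
    (fun n => \sum_(j < n) a j *: tensor (phi j) (phi j) x) @ \oo --> f x.

End operators.

Section random_elements.
Context (R : realType) (H : completeNormedModType R) (ip : {dot H for idfun}).
Context d (T : measurableType d) (P : probability T R).

Definition random_element (Y : T -> H) :=
  measurable_fun [set: T] (Y : T -> borel H).

(** [m] is the Bochner expectation of [Y]: for separable [H] it exists as soon
    as [E|Y|] is finite, and is then the only [m] with [<m, y> = E<Y, y>] for
    all [y]. *)
Definition is_expectation (Y : T -> H) (m : H) :=
  [/\ random_element Y,
      P.-integrable [set: T] (fun w => (`|Y w|)%:E) &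
      forall y : H, 'E_P[fun w => ip (Y w) y]%E = (ip m y)%:E].

Definition independent_family (I : choiceType) (Y : I -> T -> H) :=
  forall (J : {fset I}) (A : I -> set (borel H)),
    (forall i, measurable (A i)) ->
    P (\bigcap_(i in [set` J]) (Y i @^-1` A i)) =
    (\prod_(i <- J) P (Y i @^-1` A i))%E.

Definition identically_distributed (I : Type) (Y : I -> T -> H) :=
  forall (i i' : I) (A : set (borel H)), measurable A ->
    P (Y i @^-1` A) = P (Y i' @^-1` A).

Record strong_white_noise (eps : int -> T -> H) : Prop := {
  swn_measurable : forall n, random_element (eps n);
  swn_independent : independent_family eps;
  swn_identically_distributed : identically_distributed eps;
  swn_mean : forall n, is_expectation (eps n) 0;
  swn_variance : exists s2 : R,
    forall n, 'E_P[fun w => (`|eps n w| ^+ 2)%R]%E = s2%:E }.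

Record ARH1 (rho : {linear H -> H}) (eps X : int -> T -> H) : Prop := {
  arh1_continuous : continuous rho;
  arh1_opnorm : (opnorm rho < 1%:E)%E;
  arh1_noise : strong_white_noise eps;
  arh1_measurable : forall n, random_element (X n);
  arh1_mean : forall n, is_expectation (X n) 0;
  arh1_equation : forall n,
    {ae P, forall w, X n w = rho (X (n - 1) w) + eps n w};
  arh1_stationary_solution : forall n,
    {ae P, forall w,
      (fun m => \sum_(k < m) iter k rho (eps (n - k%:Z) w)) @ \oo --> X n w} }.

Definition is_autocovariance (X : int -> T -> H) (C : H -> H) :=
  forall (n : int) (z : H),
    is_expectation (fun w => tensor ip (X n w) (X n w) z) (C z).

(** Eigenvalues and eigenvectors are indexed from [0], so that [Cj j] and
    [phi j] are the (j+1)-st ones. *)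
Record autocovariance_assumption (e : nat -> H) (X : int -> T -> H)
    (C : {linear H -> H}) (Cj : nat -> R) (phi : nat -> H) : Prop := {
  autocov_continuous : continuous C;
  autocov_def : is_autocovariance X C;
  autocov_positive : positive_op ip C;
  autocov_self_adjoint : self_adjoint ip C;
  autocov_trace_class : (trace ip e C < +oo)%E;
  autocov_orthonormal : orthonormal_system ip phi;
  autocov_diagonal : diagonal_in ip phi Cj C;
  autocov_nonincreasing : forall i j, (i <= j)%N -> Cj j <= Cj i;
  autocov_gt0 : forall j, 0 < Cj j;
  autocov_summable : cvgn (series Cj) }.

Record autocorrelation_assumption (e : nat -> H) (rho : H -> H)
    (rhoj : nat -> R) (phi : nat -> H) : Prop := {
  autocorr_self_adjoint : self_adjoint ip rho;
  autocorr_hilbert_schmidt : (hs_norm e rho < +oo)%E;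
  autocorr_diagonal : diagonal_in ip phi rhoj rho;
  autocorr_summable : cvgn (series (fun j => rhoj j ^+ 2)) }.

Definition coef_along (phi : nat -> H) (Y : int -> T -> H) (n : int) (j : nat)
  (w : T) : R := ip (Y n w) (phi j).

Definition eta phi (Cj : nat -> R) (X : int -> T -> H) j n w : R :=
  coef_along phi X n j w / Num.sqrt (Cj j).

Definition eta_tilde phi (Cj rhoj : nat -> R) (eps : int -> T -> H) j n w : R :=
  coef_along phi eps n j w / Num.sqrt (Cj j * (1 - rhoj j ^+ 2)).

Definition D_hat phi X (n j : nat) w : R :=
  (n.-1)%:R^-1 * \sum_(i < n.-1) coef_along phi X i%:Z j w * coef_along phi X i.+1%:Z j w.

Definition C_hat phi X (n j : nat) w : R :=
  n%:R^-1 * \sum_(i < n) coef_along phi X i%:Z j w ^+ 2.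

Definition rho_hat phi X (n j : nat) w : R :=
  D_hat phi X n j w / C_hat phi X n j w.

Definition rho_hat_op phi X (k : nat -> nat) (n : nat) w : H -> H :=
  fun x => \sum_(j < k n) rho_hat phi X n j w *: tensor ip (phi j) (phi j) x.

(** The rank from which the two bounds hold may depend on [j]. *)
Record moment_assumption phi (Cj rhoj : nat -> R) (X : int -> T -> H)
    (K1 K2 : nat -> R) : Prop := {
  moment_K1_gt0 : forall j, 0 < K1 j;
  moment_K2_gt0 : forall j, 0 < K2 j;
  moment_variance : forall j, \forall n \near \oo,
    ('E_P[fun w => ((1 - n%:R^-1 *
        \sum_(i < n) eta phi Cj X j i%:Z w ^+ 2) ^+ 2)%R]
      <= (K1 j / n%:R)%:E)%E;
  moment_covariance : forall j, \forall n \near \oo,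
    ('E_P[fun w => ((rhoj j - (n.-1)%:R^-1 *
        \sum_(i < n.-1) eta phi Cj X j i%:Z w * eta phi Cj X j i.+1%:Z w) ^+ 2)%R]
      <= (K2 j / n%:R)%:E)%E;
  moment_sup : has_ubound (range (fun j => K1 j + K2 j)) }.

Definition cvg0_in_probability (Y : nat -> T -> \bar R) :=
  forall delta : R, 0 < delta ->
    (fun n => P [set w | (delta%:E < `|Y n w|)%E]) @ \oo --> 0%:E.

End random_elements.

(* Main.v *)
(** For the [j]-th coordinate write [x i] for [X_{i,j} / sqrt C_j],
    [u i = x (i + 1) - rho_j x i] for the normalised innovation, and [N], [F] for
    the sums over [i < m] of [x i u i] and of [u i ^ 2 - (1 - rho_j ^ 2)]. The
    recursion satisfied by [x i ^ 2] bounds [(rho_j - rho_hat_{m+1,j}) ^ 2] by a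
    multiple of [(N/m)^2 + (F/m)^2 + x_m^2/m + (sum_{i<m} x_i^2)/m^2] as soon as
    this quantity is small, and its mean is [O(1/m)] uniformly in [j]. As [C_j]
    is nonincreasing and summable, A3 forces [k_n / n -> 0], and one Markov
    inequality for the sum over [j < k_n] concludes.

    In A4 the rank from which the bounds hold may depend on [j], so they cannot
    be used at the sample size [n]. They only serve to bound, uniformly in [j],
    the variance [w] of [u i ^ 2], which does not depend on [i]: the sum of
    [u i ^ 2 - (1 - rho_j ^ 2)] over [n <= i < 2 n] has second moment [n w], and
    it is a combination of [N]-type sums and of partial sums of [x i ^ 2 - 1],
    which A4 controls for [n] large enough. *)

Require Import Defs.
From HB Require Import structures.
From mathcomp Require Import all_boot all_order all_algebra.
From mathcomp Require Import finmap.
From mathcomp Require Import zify ring lra.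
From mathcomp Require Import all_classical all_reals all_analysis.
From mathcomp Require Import measurable_realfun.

Set Implicit Arguments.
Unset Strict Implicit.
Unset Printing Implicit Defensive.

Import Order.TTheory GRing.Theory Num.Theory.
Import numFieldNormedType.Exports.

Local Open Scope classical_set_scope.
Local Open Scope ring_scope.

(** * Orthonormal systems and Hilbert-Schmidt norms *)

Section hilbert.
Context (R : realType) (H : normedModType R) (ip : {dot H for idfun}).
Hypothesis norm_ip : induces_norm ip.
Implicit Types x y z : H.

Lemma ipC x y : ip x y = ip y x.
Proof. by rewrite (@hermC _ _ _ _ ip x y)/= expr0 mul1r. Qed.

Lemma ip_sumr (I : Type) (r : seq I) (p : pred I) (F : I -> H) y :
  ip y (\sum_(i <- r | p i) F i) = \sum_(i <- r | p i) ip y (F i).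
Proof. by rewrite linear_sum. Qed.

Lemma ipZr a x y : ip x (a *: y) = a * ip x y.
Proof. by rewrite linearZ. Qed.

Lemma ipBr x y z : ip x (y - z) = ip x y - ip x z.
Proof. by rewrite linearB. Qed.

(** Nonnegativity of the squared norm of [x - c *: y], where [c *: y] is the orthogonal projection
    of [x] on the line of [y]. *)
Lemma ip_cauchy x y : `|ip x y| <= `|x| * `|y|.
Proof.
have [->|y0] := eqVneq y 0.
  by rewrite linear0 !normr0 mulr0.
have ny : 0 < `|y| ^+ 2 by rewrite exprn_gt0// normr_gt0.
rewrite -ler_sqr ?nnegrE ?mulr_ge0// exprMn real_normK ?num_real//.
set c := ip x y / `|y| ^+ 2.
have : 0 <= ip (x - c *: y) (x - c *: y) by rewrite -norm_ip sqr_ge0.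
rewrite ipBr ipZr !(ipC (x - c *: y)) !ipBr !ipZr (ipC y x) -!norm_ip.
rewrite /c; have := ny; move: (`|x| ^+ 2) (`|y| ^+ 2) (ip x y) => a b t b0.
have -> : a - t / b * t - t / b * (t - t / b * b) = (a * b - t ^+ 2) / b.
  by field; rewrite gt_eqF.
by rewrite pmulr_lge0 ?invr_gt0// subr_ge0.
Qed.

Lemma continuous_ipr y : continuous (ip y).
Proof.
apply: (@bounded_linear_continuous _ _ _ (ip y : {linear H -> R^o})).
apply/linear_boundedP; exists `|y|; split; first exact: num_real.
move=> r yr x; apply: le_trans (ip_cauchy y x) _.
by rewrite ler_wpM2r// ltW.
Qed.

Lemma cvg_ipr y (u : nat -> H) x : u @ \oo --> x ->
  (fun n => ip y (u n)) @ \oo --> ip y x.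
Proof. by move=> ux; apply: continuous_cvg ux; exact: continuous_ipr. Qed.

Lemma orthonormal_sum_norm phi (a : nat -> R) n : orthonormal_system ip phi ->
  `|\sum_(j < n) a j *: phi j| ^+ 2 = \sum_(j < n) a j ^+ 2.
Proof.
move=> onphi; rewrite norm_ip ip_sumr; apply: eq_bigr => i _.
rewrite ipZr ipC ip_sumr (bigD1 i)//= ipZr onphi eqxx mulr1 big1 ?addr0//.
move=> j ji; rewrite ipZr onphi.
have -> : (nat_of_ord i == j) = false by apply: contraNF ji => /eqP ij; apply/eqP/val_inj.
by rewrite mulr0.
Qed.

Lemma cvg_sqr_nneseries (a : nat -> R) l :
  (fun n => \sum_(j < n) a j ^+ 2) @ \oo --> l ->
  (\sum_(0 <= j <oo) (a j ^+ 2)%:E)%E = l%:E.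
Proof.
move=> al; apply/cvg_lim => //.
have -> : (fun n => \sum_(0 <= j < n) (a j ^+ 2)%:E)%E =
    EFin \o (fun n => \sum_(j < n) a j ^+ 2).
  by apply/funext => n /=; rewrite big_mkord sumEFin.
by apply: cvg_EFin al; exact: nearW.
Qed.

(** The squared norms of the partial sums are the partial sums of [a j ^+ 2], and the norm is
    continuous. *)
Lemma orthonormal_sum_cvg phi (a : nat -> R) y : orthonormal_system ip phi ->
  (fun n => \sum_(j < n) a j *: phi j) @ \oo --> y ->
  (\sum_(0 <= j <oo) (a j ^+ 2)%:E)%E = (`|y| ^+ 2)%:E.
Proof.
move=> onphi ay; apply: cvg_sqr_nneseries.
have -> : (fun n => \sum_(j < n) a j ^+ 2) =
    (fun n => `|\sum_(j < n) a j *: phi j| * `|\sum_(j < n) a j *: phi j|).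
  by apply/funext => n; rewrite -expr2 orthonormal_sum_norm.
by rewrite expr2; apply: cvgM; exact: cvg_norm.
Qed.

Lemma orthonormal_norm phi j : orthonormal_system ip phi -> `|phi j| = 1.
Proof.
move=> onphi; apply/eqP; rewrite -sqrp_eq1// norm_ip onphi eqxx//.
Qed.

Lemma parseval e x : orthonormal_basis ip e ->
  (\sum_(0 <= k <oo) (ip (e k) x ^+ 2)%:E)%E = (`|x| ^+ 2)%:E.
Proof. by case=> one ex; exact: (orthonormal_sum_cvg one (ex x)). Qed.

(** Expanding [f (e k)] along [phi] gives a double series with nonnegative terms. After exchanging
    the sums, Parseval in [e] reduces the sum over [k] to [|phi j| ^ 2 = 1]. *)
Lemma diagonal_hs_norm e phi a f : orthonormal_basis ip e ->
  orthonormal_system ip phi -> diagonal_in ip phi a f ->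
  hs_norm e f = ((\sum_(0 <= j <oo) (a j ^+ 2)%:E) `^ 2^-1)%E.
Proof.
move=> be onphi fd; congr (_ `^ _)%E.
transitivity (\sum_(0 <= k <oo) \sum_(0 <= j <oo)
    ((a j * ip (phi j) (e k)) ^+ 2)%:E)%E.
  apply: eq_eseriesr => k _; symmetry; apply: (@orthonormal_sum_cvg phi) => //.
  have := fd (e k); rewrite /tensor.
  by under eq_fun do under eq_bigr do rewrite scalerA.
rewrite nneseries_interchange; last by move=> *; rewrite lee_fin sqr_ge0.
apply: eq_eseriesr => j _.
under eq_eseriesr do rewrite exprMn EFinM ipC.
rewrite nneseriesZl; last by move=> *; rewrite lee_fin sqr_ge0.
by rewrite parseval// orthonormal_norm// expr1n mule1.
Qed.

Lemma diagonal_eigen phi a f j : orthonormal_system ip phi ->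
  diagonal_in ip phi a f -> f (phi j) = a j *: phi j.
Proof.
move=> onphi /(_ (phi j)) fd.
suff : (fun n => \sum_(i < n) a i *: tensor ip (phi i) (phi i) (phi j)) @ \oo -->
    a j *: phi j by apply: cvg_unique fd; exact: norm_hausdorff.
apply: cvg_near_cst.
near=> n; have jn : (j < n)%N by near: n; exact: nbhs_infty_gt.
rewrite (bigD1 (Ordinal jn))//= /tensor onphi eqxx scale1r big1 ?addr0// => i ij.
rewrite onphi; have -> : (nat_of_ord i == j) = false.
  by apply: contraNF ij => /eqP ij; apply/eqP/val_inj.
by rewrite scale0r scaler0.
Unshelve. all: by end_near. Qed.

(** Presents the estimation error as a diagonal operator, to which [diagonal_hs_norm] applies. *)
Lemma diagonal_sub phi a b m f : diagonal_in ip phi a f ->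
  diagonal_in ip phi (fun j => a j - (if (j < m)%N then b j else 0))
    (fun x => f x - \sum_(j < m) b j *: tensor ip (phi j) (phi j) x).
Proof.
move=> fd x.
have fb : (fun n => \sum_(j < n) (if (j < m)%N then b j else 0) *:
    tensor ip (phi j) (phi j) x) @ \oo -->
    \sum_(j < m) b j *: tensor ip (phi j) (phi j) x.
  apply: cvg_near_cst; near=> n.
  have mn : (m <= n)%N by near: n; exact: nbhs_infty_ge.
  rewrite (big_ord_widen n (fun j => b j *: tensor ip (phi j) (phi j) x))//.
  rewrite [RHS]big_mkcond; apply: eq_bigr => i _.
  by case: ifP => // _; rewrite scale0r.
apply: cvg_trans (cvgB (fd x) fb); apply: near_eq_cvg; apply: nearW => n /=.
by rewrite fctE -sumrB; apply: eq_bigr => i _; rewrite scalerBl.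
Unshelve. all: by end_near. Qed.

End hilbert.

(** * Independence *)

Section independent_product.
Context (R : realType) d (T : measurableType d) (P : probability T R).

(** The product rule on rectangles identifies the joint law with the product of the two laws; Fubini
    then factors the integral. *)
Lemma independent_integral_mul (X Y : {mfun T >-> R}) :
  (forall A B, measurable A -> measurable B ->
    P (X @^-1` A `&` Y @^-1` B) = (P (X @^-1` A) * P (Y @^-1` B))%E) ->
  P.-integrable setT (EFin \o X) -> P.-integrable setT (EFin \o Y) ->
  P.-integrable setT (EFin \o (fun w => X w * Y w)) /\
  Rintegral P setT (fun w => X w * Y w) =
  Rintegral P setT X * Rintegral P setT Y.
Proof.
move=> XY iX iY.
have mXY : measurable_fun [set: T] (fun w => (X w, Y w)).
  by apply/measurable_fun_pairP; split.
pose XYm : {mfun T >-> (R * R)%type} := mfun_Sub (mem_set mXY).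
have lawE : forall S, measurable S ->
    (distribution P X \x distribution P Y)%E S = distribution P XYm S.
  apply: product_measure_unique => A B mA mB.
  by rewrite /= /distribution/= /pushforward -XY.
pose h (z : R * R) := ((z.1 * z.2)%:E : \bar R).
have mh : measurable_fun setT h.
  by apply/measurable_EFinP; apply: measurable_funM.
have nX : (\int[distribution P X]_x `|x%:E| < +oo)%E.
  rewrite ge0_integral_distribution//.
    by case/integrableP : iX.
  by apply: measurableT_comp.
have nY : (\int[distribution P Y]_x `|x%:E| < +oo)%E.
  rewrite ge0_integral_distribution//.
    by case/integrableP : iY.
  by apply: measurableT_comp.
(* Tonelli: the iterated integral of the absolute value is the product of the two absolute first
   moments. *)
have iprod : (distribution P X \x distribution P Y)%E.-integrable setT h.
  apply/integrable12ltyP => //.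
  under eq_integral => x _.
    under eq_integral do rewrite /h /= normrM EFinM.
    rewrite ge0_integralZl//; last by apply/measurable_EFinP.
    over.
  rewrite ge0_integralZr//.
  - by rewrite lte_mul_pinfty// ?integral_ge0// ge0_fin_numE// integral_ge0.
  - by apply/measurable_EFinP.
  - by apply: integral_ge0.
have iXYm : (distribution P XYm).-integrable setT h.
  move: iprod => /integrableP[_ hoo]; apply/integrableP; split => //.
  by rewrite (eq_measure_integral (distribution P X \x distribution P Y)%E) // => S mS _;
    exact/esym/lawE.
have iXY : P.-integrable setT (h \o XYm).
  move: iXYm => /integrableP[_ hoo]; apply/integrableP; split.
    by apply: measurableT_comp => //; exact: measurable_funPT.
  by move: hoo; rewrite ge0_integral_distribution//; exact: measurableT_comp.
split => //.
have -> : Rintegral P setT (fun w => X w * Y w) =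
    fine (\int[distribution P XYm]_z h z)%E.
  by rewrite integral_distribution.
rewrite (eq_measure_integral (distribution P X \x distribution P Y)%E); last first.
  by move=> S mS _; exact/esym/lawE.
rewrite -integral12_prod_meas1// /fubini_F.
have intX : (distribution P X).-integrable setT EFin.
  by apply/integrableP; split => //.
have intY : (distribution P Y).-integrable setT EFin.
  by apply/integrableP; split => //.
under eq_integral => x _.
  under eq_integral do rewrite /h /= EFinM.
  rewrite integralZl//.
  over.
have finX := integrable_fin_num measurableT intX.
have finY := integrable_fin_num measurableT intY.
rewrite -(fineK finY) /= integralZr// fineM//.
by congr (fine _ * fine _); rewrite ?fineK//; exact: integral_distribution.
Qed.

End independent_product.
(** Serves to pass between a variable and a version of it, as the relations between [X] and the
    noise hold only almost surely. *)
Lemma integrable_ae_eq (R : realType) d (T : measurableType d)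
    (P : {measure set T -> \bar R}) (f g : T -> R) :
  measurable_fun setT f -> measurable_fun setT g ->
  {ae P, forall w, f w = g w} -> P.-integrable setT (EFin \o f) ->
  P.-integrable setT (EFin \o g) /\ Rintegral P setT f = Rintegral P setT g.
Proof.
move=> mf mg fg /integrableP[_ fi]; split; last first.
  congr fine; apply: ae_eq_integral => //; try exact/measurable_EFinP.
  by apply: filterS fg => w -> _.
apply/integrableP; split; first exact/measurable_EFinP.
rewrite (ae_eq_integral (abse \o (EFin \o f)))//.
- by apply: measurableT_comp => //; exact/measurable_EFinP.
- by apply: measurableT_comp => //; exact/measurable_EFinP.
- by apply: filterS fg => w /= -> _.
Qed.

(** * The sigma-algebra generated by part of an independent family *)

Section generated_past.
Context (R : realType) (H : completeNormedModType R).
Context d (T : measurableType d) (P : probability T R).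
Context (I : choiceType) (Y : I -> T -> H).
Hypothesis mY : forall i, random_element (Y i).
Hypothesis indY : independent_family P Y.
Implicit Types D : set I.

(** A pi-system generating the sigma-algebra of the [Y i], [D i]. *)
Definition cylinders D : set (set T) :=
  [set B | exists (J : {fset I}) (A : I -> set (borel H)),
    [/\ (forall i, i \in J -> D i), (forall i, measurable (A i)) &
        B = \bigcap_(i in [set` J]) (Y i @^-1` A i)]].

Lemma cylinders_setI D : setI_closed (cylinders D).
Proof.
move=> _ _ [J [A [JD mA ->]]] [J' [A' [JD' mA' ->]]].
(* Both conditions are put on a common index set, with the whole space wherever one of them imposes
   nothing. *)
exists (J `|` J')%fset, (fun i => (if i \in J then A i else setT) `&`
  (if i \in J' then A' i else setT)); split.
- by move=> i; rewrite in_fsetU => /orP[/JD|/JD'].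
- by move=> i; apply: measurableI; case: ifP.
- apply/seteqP; split => [w [h h'] i /= _|w h].
    by split; case: ifPn => // ij; [exact: h|exact: h'].
  by split => i /= ij; have := h i; rewrite /= in_fsetU ij ?orbT => /(_ isT)[].
Qed.

Lemma measurable_preimage i (A : set (borel H)) :
  measurable A -> measurable (Y i @^-1` A).
Proof. by move=> mA; rewrite -[X in measurable X]setTI; exact: (mY i). Qed.

Lemma measurable_cylinders D : cylinders D `<=` measurable.
Proof.
move=> _ [J [A [_ mA ->]]]; apply: fin_bigcap_measurable.
  exact: finite_fset.
by move=> i _; exact: measurable_preimage.
Qed.

Lemma measurable_past D : <<s cylinders D >> `<=` measurable.
Proof.
apply: smallest_sub; last exact: measurable_cylinders.
exact: sigma_algebra_measurable.
Qed.

(** Dynkin's argument. A cylinder over [J], met with a condition at [i0], is again a finite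
    intersection of conditions on distinct variables, because [i0] is not in [J]. *)
Lemma past_independent D i0 (A : set (borel H)) B :
  ~ D i0 -> measurable A -> <<s cylinders D >> B ->
  P (B `&` Y i0 @^-1` A) = (P B * P (Y i0 @^-1` A))%E.
Proof.
move=> Di0 mA; set E := _ @^-1` A.
have mE : measurable E by exact: measurable_preimage.
pose T' := g_sigma_algebraType (cylinders D).
apply: (@dynkin_induction _ T' (cylinders D)
  (fun B => P (B `&` E) = (P B * P E)%E)) => //.
- exact: cylinders_setI.
- by rewrite setTI probability_setT mul1e.
- move=> _ [J [A' [JD mA' ->]]].
  have Ji0 : i0 \notin J by apply/negP => /JD.
  pose A2 i := if i == i0 then A else A' i.
  have -> : \bigcap_(i in [set` J]) (Y i @^-1` A' i) `&` E =
      \bigcap_(i in [set` (i0 |` J)%fset]) (Y i @^-1` A2 i).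
    rewrite /A2; apply/seteqP; split => [w [h Ew] i /=|w h].
      by rewrite !inE; case: eqP => [-> _|_ /= iJ]; [|exact: h].
    split; last by have := h i0; rewrite /= !inE eqxx; exact.
    move=> i /= iJ; have := h i; rewrite /= !inE iJ orbT => /(_ isT).
    by case: eqP iJ Ji0 => // -> ->.
  rewrite !indY//; last by move=> i; rewrite /A2; case: ifP.
  rewrite big_fsetU1//= /A2 eqxx muleC; congr (_ * _)%E.
  apply: eq_big_seq => i iJ; case: eqP iJ Ji0 => // -> iJ.
  by rewrite iJ.
- move=> S mS PS.
  have {}mS : d.-measurable S by exact: (@measurable_past D).
  rewrite probability_setC// muleBl ?fin_num_measure//.
  rewrite -PS mul1e setIC -setDE; apply/esym.
  by rewrite (measureDI P mE mS) (setIC E S) addeK// fin_num_measure//; exact: measurableI.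
- move=> F mF tF PF.
  have {}mF n : d.-measurable (F n) by exact: (measurable_past (mF n)).
  rewrite setI_bigcupl measure_bigcup//=.
  - rewrite measure_bigcup//=.
    under eq_eseriesr do rewrite PF muleC.
    rewrite -[P E in LHS](@fineK _ (P E)) ?fin_num_measure// nneseriesZl//.
    by rewrite muleC fineK ?fin_num_measure.
  - by move=> n _; exact: measurableI.
  - exact: trivIset_setIr.
Qed.

(** Only up to a null set: [X_n] is an almost sure limit of functions of the
    noise. *)
Definition past_measurable D (f : T -> R) :=
  exists2 f' : g_sigma_algebraType (cylinders D) -> R,
    measurable_fun setT f' & {ae P, forall w, f w = f' w}.

Lemma past_measurable_coord D i (h : borel H -> R) :
  D i -> measurable_fun setT h -> past_measurable D (fun w => h (Y i w)).
Proof.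
move=> Di mh; exists (fun w => h (Y i w)); last exact: aeW.
move=> _ B mB; rewrite setTI; apply: sub_sigma_algebra.
exists [fset i]%fset, (fun=> h @^-1` B); split.
- by move=> j; rewrite inE => /eqP ->.
- by move=> _; rewrite -[X in measurable X]setTI; exact: mh.
- apply/seteqP; split=> [w hw j /=|w]; first by rewrite inE => /eqP ->.
  by move=> /(_ i); apply; rewrite /= inE.
Qed.

Lemma past_measurableD D f g : past_measurable D f -> past_measurable D g ->
  past_measurable D (fun w => f w + g w).
Proof.
move=> [f' mf' ff'] [g' mg' gg']; exists (f' \+ g'); first exact: measurable_funD.
by apply: filterS2 ff' gg' => w -> ->.
Qed.

Lemma past_measurableM D f g : past_measurable D f -> past_measurable D g ->
  past_measurable D (fun w => f w * g w).
Proof.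
move=> [f' mf' ff'] [g' mg' gg']; exists (f' \* g'); first exact: measurable_funM.
by apply: filterS2 ff' gg' => w -> ->.
Qed.

Lemma past_measurable_cst D r : past_measurable D (fun=> r).
Proof. by exists (fun=> r); [exact: measurable_cst|exact: aeW]. Qed.

Lemma past_measurable_sum D n (F : 'I_n -> T -> R) :
  (forall k, past_measurable D (F k)) ->
  past_measurable D (fun w => \sum_(k < n) F k w).
Proof.
elim: n F => [|n IH] F mF.
  have -> : (fun w => \sum_(k < 0) F k w) = fun=> 0.
    by apply/funext => w; rewrite big_ord0.
  exact: past_measurable_cst.
have -> : (fun w => \sum_(k < n.+1) F k w) =
    fun w => \sum_(k < n) F (widen_ord (leqnSn n) k) w + F ord_max w.
  by apply/funext => w; rewrite big_ord_recr.
by apply: past_measurableD => //; exact: IH.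
Qed.

Lemma past_measurableS D D' f : D `<=` D' ->
  past_measurable D f -> past_measurable D' f.
Proof.
move=> DD' [f' mf' ff']; exists f' => // _ B mB.
have : <<s cylinders D >> (setT `&` f' @^-1` B) by exact: (mf' measurableT).
apply: sub_smallest2r; first exact: smallest_sigma_algebra.
move=> A [J [A' [JD mA' ->]]].
by exists J, A'; split => // i /JD /DD'.
Qed.

(** The limit superior of the measurable versions is measurable and equals the limit off a null set.
    It is taken in the extended reals, where it always exists, and brought back by [fine]. *)
Lemma past_measurable_cvg D (f_ : nat -> T -> R) f :
  (forall n, past_measurable D (f_ n)) ->
  {ae P, forall w, (fun n => f_ n w) @ \oo --> f w} -> past_measurable D f.
Proof.
move=> /(_ _)/cid2 mf_ cf.
pose f' n := s2val (mf_ n).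
exists (fun w => fine (limn_esup (fun n => (f' n w)%:E))).
  apply: measurableT_comp => //.
  apply: (@measurable_fun_limn_esup _ _ _ _ (fun n w => (f' n w)%:E)) => n.
  by apply/measurable_EFinP; exact: s2valP.
have := ae_foralln (fun n => s2valP' (mf_ n)).
apply: filterS2 cf => w fw ff'.
have : (fun n => (f' n w)%:E) @ \oo --> (f w)%:E.
  apply: cvg_EFin; first exact: nearW.
  apply: cvg_trans fw; apply: near_eq_cvg; apply: nearW => n /=.
  by rewrite ff'.
move=> h; rewrite is_cvg_limn_esupE; last by apply/cvg_ex; exists (f w)%:E.
by rewrite (cvg_lim _ h).
Qed.

(** The measurable version of [f] is independent of [Y i0] by [past_independent]; the product
    formula holds for it and transfers to [f]. *)
Lemma past_integral_mul D i0 f (h : borel H -> R) : ~ D i0 ->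
  past_measurable D f -> measurable_fun setT f -> measurable_fun setT h ->
  P.-integrable setT (EFin \o f) ->
  P.-integrable setT (EFin \o (fun w => h (Y i0 w))) ->
  P.-integrable setT (EFin \o (fun w => f w * h (Y i0 w))) /\
  Rintegral P setT (fun w => f w * h (Y i0 w)) =
  Rintegral P setT f * Rintegral P setT (fun w => h (Y i0 w)).
Proof.
move=> Di0 [f' mf' ff'] mf mh intf inth.
have mf'T : measurable_fun [set: T] f'.
  by move=> _ B mB; exact: measurable_past (mf' measurableT _ mB).
have mhY : measurable_fun [set: T] (fun w => h (Y i0 w)).
  by apply: (@measurableT_comp _ _ _ _ (borel H) _ h _ (Y i0)); [|exact: mY].
have intf' : P.-integrable setT (EFin \o f').
  by have [] := integrable_ae_eq mf mf'T ff' intf.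
pose F : {mfun T >-> R} := mfun_Sub (mem_set mf'T).
pose G : {mfun T >-> R} := mfun_Sub (mem_set mhY).
have [A B mA mB|//|//|i1 i2] := @independent_integral_mul _ _ _ P F G.
  rewrite /F /G /=.
  have -> : (fun w => h (Y i0 w)) @^-1` B = Y i0 @^-1` (h @^-1` B) by [].
  apply: (@past_independent D) => //.
    by rewrite -[X in measurable X]setTI; exact: mh.
  by have := mf' measurableT _ mA; rewrite setTI.
have efg : {ae P, forall w, f' w * h (Y i0 w) = f w * h (Y i0 w)}.
  by apply: filterS ff' => w ->.
have [i3 i4] := integrable_ae_eq (measurable_funM mf'T mhY)
  (measurable_funM mf mhY) efg i1.
split => //; rewrite -i4 i2; congr (_ * _).
by have [_ ->] := integrable_ae_eq mf mf'T ff' intf.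
Qed.

End generated_past.

(** * Square integrable random variables *)

Section square_integrable.
Context (R : realType) d (T : measurableType d) (P : probability T R).
Local Notation intg f := (P.-integrable setT (EFin \o f)).
Local Notation E f := (Rintegral P setT f).
Implicit Types f g : T -> R.

Definition square_integrable f :=
  measurable_fun setT f /\ intg (fun w => f w ^+ 2).

Local Notation L2 := square_integrable.

Lemma integrable_le f g : measurable_fun setT f -> intg g ->
  (forall w, `|f w| <= g w) -> intg f.
Proof.
move=> mf ig fg; apply: le_integrable ig => //.
  exact/measurable_EFinP.
by move=> w _ /=; rewrite lee_fin; apply: le_trans (fg w) (ler_norm _).
Qed.

Lemma integrable_add f g : intg f -> intg g -> intg (fun w => f w + g w).
Proof. by move=> i1 i2; have := integrableD measurableT i1 i2. Qed.

Lemma integrable_scale a f : intg f -> intg (fun w => a * f w).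
Proof. by move=> i1; have := integrableZl measurableT a i1. Qed.

Lemma integrable_const a : intg (fun=> a).
Proof. exact: finite_measure_integrable_cst. Qed.

Lemma L2_cst a : L2 (fun=> a).
Proof. by split; [exact: measurable_cst|exact: integrable_const]. Qed.

Lemma L2_mul f g : L2 f -> L2 g -> intg (fun w => f w * g w).
Proof.
move=> [mf f2] [mg g2]; apply: integrable_le (integrable_add f2 g2) _.
  exact: measurable_funM.
move=> w; rewrite normrM -[f w ^+ 2]real_normK ?num_real//.
rewrite -[g w ^+ 2]real_normK ?num_real//.
have := sqr_ge0 (`|f w| - `|g w|); have := normr_ge0 (f w).
by have := normr_ge0 (g w); nra.
Qed.

Lemma L2_int f : L2 f -> intg f.
Proof.
by move=> h; have := L2_mul h (L2_cst 1); under eq_fun do rewrite mulr1.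
Qed.

Lemma L2D f g : L2 f -> L2 g -> L2 (fun w => f w + g w).
Proof.
move=> hf hg; have [mf f2] := hf; have [mg g2] := hg; split.
  exact: measurable_funD.
under eq_fun do rewrite sqrrD -mulr_natl.
by do 2 apply: integrable_add => //; apply: integrable_scale; exact: L2_mul.
Qed.

Lemma L2Z a f : L2 f -> L2 (fun w => a * f w).
Proof.
move=> [mf f2]; split; first exact: measurable_funM.
by under eq_fun do rewrite exprMn; exact: integrable_scale.
Qed.

Lemma L2B f g : L2 f -> L2 g -> L2 (fun w => f w - g w).
Proof.
move=> hf hg; under eq_fun do rewrite -mulN1r.
by apply: L2D => //; exact: L2Z.
Qed.

Lemma L2_sum n (F : nat -> T -> R) : (forall i, L2 (F i)) ->
  L2 (fun w => \sum_(i < n) F i w).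
Proof.
move=> hF; elim: n => [|n IH].
  by under eq_fun do rewrite big_ord0; exact: L2_cst.
by under eq_fun do rewrite big_ord_recr; exact: L2D.
Qed.

Lemma mean_add f g : intg f -> intg g -> E (fun w => f w + g w) = E f + E g.
Proof. by move=> *; rewrite RintegralD. Qed.

Lemma mean_scale a f : intg f -> E (fun w => a * f w) = a * E f.
Proof. by move=> *; rewrite RintegralZl. Qed.

Lemma mean_const a : E (fun=> a) = a.
Proof.
by rewrite Rintegral_cst// [X in fine X](_ : _ = 1%E) ?mulr1//; exact: probability_setT.
Qed.

Lemma mean_le f g : intg f -> intg g -> (forall w, f w <= g w) -> E f <= E g.
Proof. by move=> *; exact: le_Rintegral. Qed.

Lemma integrable_ord_sum n (F : nat -> T -> R) : (forall i, intg (F i)) ->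
  intg (fun w => \sum_(i < n) F i w).
Proof.
move=> hF; elim: n => [|n IH].
  by under eq_fun do rewrite big_ord0; exact: integrable_const.
by under eq_fun do rewrite big_ord_recr; exact: integrable_add.
Qed.

Lemma mean_sum n (F : nat -> T -> R) : (forall i, intg (F i)) ->
  E (fun w => \sum_(i < n) F i w) = \sum_(i < n) E (F i).
Proof.
move=> hF; elim: n => [|n IH].
  by under eq_Rintegral do rewrite big_ord0; rewrite mean_const big_ord0.
under eq_Rintegral do rewrite big_ord_recr.
by rewrite mean_add ?IH ?big_ord_recr//; exact: integrable_ord_sum.
Qed.

(** Pythagoras by induction: the cross term between the partial sum and the next variable is a sum
    of vanishing expectations. *)
Lemma orthogonal_sum n (F : nat -> T -> R) c : (forall i, L2 (F i)) ->
  (forall i j, (i < j)%N -> E (fun w => F i w * F j w) = 0) ->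
  (forall i, E (fun w => F i w ^+ 2) = c) ->
  E (fun w => (\sum_(i < n) F i w) ^+ 2) = n%:R * c.
Proof.
move=> hF orth cF; elim: n => [|n IH].
  under eq_Rintegral do rewrite big_ord0 expr0n.
  by rewrite mean_const mul0r.
under eq_Rintegral do rewrite big_ord_recr /= sqrrD -mulr_natl.
have hS := L2_sum n hF.
have iM : intg (fun w => (\sum_(i < n) F i w) * F n w) by exact: L2_mul.
have [_ iS] := hS; have [_ iF] := hF n.
rewrite mean_add//; last by apply: integrable_add => //; exact: integrable_scale.
rewrite mean_add//; last exact: integrable_scale.
rewrite IH cF mean_scale//.
under eq_Rintegral do rewrite mulr_suml.
rewrite (mean_sum n (F := fun i w => F i w * F n w)).
  by rewrite big1 ?mulr0 ?addr0 ?mulrSr ?mulrDl ?mul1r// => i _; exact: orth.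
by move=> i; exact: L2_mul.
Qed.

End square_integrable.
(** * Autoregressive sequences *)

Section noise_kurtosis.
Context (R : realType) d (T : measurableType d) (P : probability T R).
Local Notation E f := (Rintegral P setT f).
Local Notation L2 := (square_integrable P).
Context (x : nat -> T -> R) (rho w K : R).
Let s2 := 1 - rho ^+ 2.
Let u i t := x i.+1 t - rho * x i t.
Let S n t := \sum_(i < n) (x i t ^+ 2 - 1).

(** Sum of the squared recursion [x i.+1 ^ 2 = rho ^ 2 * x i ^ 2 + 2 * rho * x i * u i + u i ^ 2];
    the shifted sum of centred squares is [S n.+1 - S 1]. *)
Lemma square_partial_sum_rec n t :
  \sum_(i < n) (u i t ^+ 2 - s2) =
  S n.+1 t - S 1 t - rho ^+ 2 * S n t - 2 * rho * \sum_(i < n) (x i t * u i t).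
Proof.
elim: n => [|n IH]; first by rewrite /S !big_ord0; ring.
by rewrite !big_ord_recr /= IH /S !big_ord_recr /= /u /s2; ring.
Qed.

(** Subtracting the previous identity at [n] from that at [n + n] cancels [S 1], a sum too short for
    an asymptotic moment bound. *)
Lemma square_window_rec n t :
  \sum_(i < n) (u (n + i)%N t ^+ 2 - s2) =
  S (n + n).+1 t + (-1 * S n.+1 t + (- rho ^+ 2 * S (n + n) t + (rho ^+ 2 * S n t
    + (- 2 * rho) * \sum_(i < n) (x (n + i)%N t * u (n + i)%N t)))).
Proof.
have H1 := square_partial_sum_rec n t; have := square_partial_sum_rec (n + n) t.
rewrite !big_split_ord /= H1 => H2.
by apply/eqP; rewrite -subr_eq0; move/eqP: H2; rewrite -subr_eq0 => /eqP H2;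
  apply/eqP; rewrite -[RHS]H2; ring.
Qed.

(** The five terms of [square_window_rec] cost a factor [5] and, [n] being at
    least [1], [(6 n + 2) K + 4 n <= n (8 K + 4)]. *)
Lemma noise_kurtosis_le : rho ^+ 2 <= 1 ->
  (forall i, L2 (fun t => x i t * u i t)) ->
  (forall i j, (i < j)%N -> E (fun t => x i t * u i t * (x j t * u j t)) = 0) ->
  (forall i, E (fun t => (x i t * u i t) ^+ 2) = s2) ->
  (forall i, L2 (fun t => u i t ^+ 2 - s2)) ->
  (forall i j, (i < j)%N -> E (fun t => (u i t ^+ 2 - s2) * (u j t ^+ 2 - s2)) = 0) ->
  (forall i, E (fun t => (u i t ^+ 2 - s2) ^+ 2) = w) ->
  (\forall n \near \oo, L2 (S n) /\ E (fun t => S n t ^+ 2) <= n%:R * K) ->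
  w <= 40 * K + 20.
Proof.
move=> rho1 L2xu oxu vxu L2uu ouu vuu [N _ HS].
(* The sizes [n], [n + 1], [2 n] and [2 n + 1] all lie beyond the rank [N], and [n] is positive. *)
pose n := N.+1.
have [L2n En] := HS n (leqnSn N).
have [L2n1 En1] : L2 (S n.+1) /\ E (fun t => S n.+1 t ^+ 2) <= n.+1%:R * K.
  by apply: HS => /=; rewrite /n; lia.
have [L2m Em] : L2 (S (n + n)) /\ E (fun t => S (n + n) t ^+ 2) <= (n + n)%:R * K.
  by apply: HS => /=; rewrite /n; lia.
have [L2m1 Em1] : L2 (S (n + n).+1) /\
    E (fun t => S (n + n).+1 t ^+ 2) <= (n + n).+1%:R * K.
  by apply: HS => /=; rewrite /n; lia.
pose V t := \sum_(i < n) (x (n + i)%N t * u (n + i)%N t).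
have L2V : L2 V by apply: (@L2_sum _ _ _ _ n (fun i t => x (n + i)%N t * u (n + i)%N t)).
have EV : E (fun t => V t ^+ 2) = n%:R * s2.
  apply: (@orthogonal_sum _ _ _ _ n (fun i t => x (n + i)%N t * u (n + i)%N t) _) => //.
  by move=> i j ij; apply: oxu; rewrite ltn_add2l.
pose F t := \sum_(i < n) (u (n + i)%N t ^+ 2 - s2).
have L2F : L2 F by apply: (@L2_sum _ _ _ _ n (fun i t => u (n + i)%N t ^+ 2 - s2)).
have EF : E (fun t => F t ^+ 2) = n%:R * w.
  apply: (@orthogonal_sum _ _ _ _ n (fun i t => u (n + i)%N t ^+ 2 - s2) _) => //.
  by move=> i j ij; apply: ouu; rewrite ltn_add2l.
have [iF [in1 im im1 iV]] : [/\ P.-integrable setT (EFin \o (fun t => F t ^+ 2)) &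
   [/\ P.-integrable setT (EFin \o (fun t => S n.+1 t ^+ 2)),
   P.-integrable setT (EFin \o (fun t => S (n + n) t ^+ 2)),
   P.-integrable setT (EFin \o (fun t => S (n + n).+1 t ^+ 2)) &
   P.-integrable setT (EFin \o (fun t => V t ^+ 2))]].
  by case: L2F L2n1 L2m L2m1 L2V => _ ? [_ ?] [_ ?] [_ ?] [_ ?].
have [_ in_] := L2n.
have i1 := integrable_add in_ (integrable_scale 4 iV).
have i2 := integrable_add im i1.
have i3 := integrable_add in1 i2.
have i4 := integrable_add im1 i3.
have : E (fun t => F t ^+ 2) <= E (fun t => 5 * (S (n + n).+1 t ^+ 2 +
    (S n.+1 t ^+ 2 + (S (n + n) t ^+ 2 + (S n t ^+ 2 + 4 * V t ^+ 2))))).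
  apply: mean_le => //; first exact: integrable_scale.
  move=> t; rewrite /F square_window_rec -/(V t).
  (* Cauchy-Schwarz for five terms, from the ten squares of differences. *)
  have sq5 (a b c e f : R) : (a + (b + (c + (e + f)))) ^+ 2 <=
      5 * (a ^+ 2 + (b ^+ 2 + (c ^+ 2 + (e ^+ 2 + f ^+ 2)))).
    have := sqr_ge0 (a - b); have := sqr_ge0 (a - c); have := sqr_ge0 (a - e).
    have := sqr_ge0 (a - f); have := sqr_ge0 (b - c); have := sqr_ge0 (b - e).
    have := sqr_ge0 (b - f); have := sqr_ge0 (c - e); have := sqr_ge0 (c - f).
    by have := sqr_ge0 (e - f); lra.
  have shrink r (a : R) : r ^+ 2 <= 1 -> (r * a) ^+ 2 <= a ^+ 2.
    by move=> r1; rewrite exprMn ler_piMl ?sqr_ge0.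
  have rho4 : (rho ^+ 2) ^+ 2 <= 1 by rewrite expr_le1// sqr_ge0.
  apply: le_trans (sq5 _ _ _ _ _) _; rewrite ler_pM2l//; apply: lerD => //.
  apply: lerD; first by apply: shrink; rewrite sqrrN expr1n.
  apply: lerD; first by apply: shrink; rewrite sqrrN.
  apply: lerD; first exact: shrink.
  rewrite (_ : - 2 * rho * V t = 2 * (- rho * V t)); last by ring.
  rewrite exprMn (_ : 2 ^+ 2 = 4); last by rewrite expr2; ring.
  by rewrite ler_pM2l//; apply: shrink; rewrite sqrrN.
rewrite EF mean_scale// mean_add// mean_add// mean_add// mean_add//;
  last exact: integrable_scale.
rewrite mean_scale// EV.
move: En En1 Em Em1 => En En1 Em Em1 H.
have s21 : s2 <= 1 by rewrite /s2 gerBl sqr_ge0.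
have n0 : 1 <= n%:R :> R by rewrite ler1n.
have HH : n%:R * s2 <= n%:R by rewrite ler_piMr// ltW// (lt_le_trans _ n0).
(* The sign of [K] serves to absorb [2 K] into [2 n K]. *)
have K0 : 0 <= K.
  have : 0 <= n%:R * K by apply: le_trans En; apply: Rintegral_ge0 => t _; exact: sqr_ge0.
  by rewrite pmulr_rge0// (lt_le_trans _ n0).
rewrite -(@ler_pM2l _ n%:R) ?(lt_le_trans _ n0)//.
move: En En1 Em Em1 H; rewrite -[n.+1]addn1 -[(n + n).+1]addn1 !natrD.
by nra.
Qed.

End noise_kurtosis.

(** Used with [m] the sample size minus one, [Q] the sum of the [x i ^ 2],
    [i < m], [a = x m ^ 2] and [b = x 0 ^ 2]. *)
Lemma ratio_estimate (R : realType) (m rho s N F Q a b : R) :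
  1 <= m -> 0 < s -> s <= 1 - rho ^+ 2 -> 0 <= Q -> 0 <= a -> 0 <= b ->
  (1 - rho ^+ 2) * Q = m * (1 - rho ^+ 2) + F + 2 * rho * N - a + b ->
  let z := (N / m) ^+ 2 + (F / m) ^+ 2 + a / m + Q / m ^+ 2 in
  z <= (s / 8) ^+ 2 ->
  (rho - ((rho * Q + N) / m) / ((Q + a) / (m + 1))) ^+ 2 <= 32 * z.
Proof.
move=> m1 s0 sr Q0 a0 b0 eQ z zs.
have m0 : 0 < m by lra.
pose N' := N / m; pose F' := F / m; pose a' := a / m; pose q := Q / m ^+ 2.
have NE : N = N' * m by rewrite /N' divfK// gt_eqF.
have FE : F = F' * m by rewrite /F' divfK// gt_eqF.
have aE : a = a' * m by rewrite /a' divfK// gt_eqF.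
have QE : Q = q * m ^+ 2 by rewrite /q divfK// gt_eqF// exprn_gt0.
have a'0 : 0 <= a' by rewrite divr_ge0// ltW.
have q0 : 0 <= q by rewrite divr_ge0// exprn_ge0// ltW.
rewrite {}/z -/N' -/F' -/a' -/q in zs *.
have r1 : rho ^+ 2 <= 1 by lra.
have s1 : s <= 1 by have := sqr_ge0 rho; lra.
have N8 : `|N'| <= s / 8.
  rewrite -ler_sqr ?nnegrE ?divr_ge0//; last by lra.
  by rewrite real_normK ?num_real//; have := sqr_ge0 F'; lra.
have F8 : `|F'| <= s / 8.
  rewrite -ler_sqr ?nnegrE ?divr_ge0//; last by lra.
  by rewrite real_normK ?num_real//; have := sqr_ge0 N'; lra.
have s8 : (s / 8) ^+ 2 <= s / 8 by rewrite expr2; nra.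
have a8 : a' <= s / 8 by have := sqr_ge0 F'; have := sqr_ge0 N'; lra.
have rN : `|rho| <= 1 by rewrite -(@expr_le1 _ 2)// real_normK// num_real.
have rN8 : `|rho * N'| <= s / 8.
  by rewrite normrM; apply: le_trans N8; rewrite ler_piMl.
(* In [(1 - rho ^ 2) * (Q + a)] the main term is [m * (1 - rho ^ 2)]; the terms in [F], [2 rho N]
   and [rho ^ 2 a] remove at most [4 * (s / 8) * m], that is, at most half of it. *)
have Qa : m / 2 <= Q + a.
  have : (1 - rho ^+ 2) * (m / 2) <= (1 - rho ^+ 2) * (Q + a).
    rewrite mulrDr eQ FE NE aE.
    have -> : m * (1 - rho ^+ 2) + F' * m + 2 * rho * (N' * m) - a' * m + b +
      (1 - rho ^+ 2) * (a' * m) = m * (1 - rho ^+ 2 + F' + 2 * (rho * N') - rho ^+ 2 * a') + b.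
      by ring.
    have -> : (1 - rho ^+ 2) * (m / 2) = m * ((1 - rho ^+ 2) / 2) by ring.
    apply: ler_wpDr => //; rewrite ler_pM2l//.
    have : rho ^+ 2 * a' <= a' by rewrite ler_piMl.
    move: F8 rN8; rewrite !ler_norml => /andP[F1 _] /andP[N1 _].
    by lra.
  by rewrite ler_pM2l//; lra.
have C0 : 1 / 4 <= (Q + a) / (m + 1).
  by rewrite ler_pdivlMr; lra.
have Cn0 : (Q + a) / (m + 1) != 0 by rewrite gt_eqF//; lra.
rewrite -(@ler_pM2r _ (((Q + a) / (m + 1)) ^+ 2)); last by rewrite exprn_gt0//; lra.
rewrite -exprMn mulrBl divfK//.
(* Cleared of its denominator, the error is [rho * L - N'], where [L] is the difference of the
   averages [(Q + a) / (m + 1)] and [Q / m]. *)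
set L := a / (m + 1) - Q / (m * (m + 1)).
have -> : rho * ((Q + a) / (m + 1)) - (rho * Q + N) / m = rho * L - N'.
  rewrite /L /N'; field.
  by rewrite !gt_eqF//; lra.
have Lz : `|L| <= a' + q.
  have La : a / (m + 1) <= a'.
    by rewrite /a' ler_wpM2l// lef_pV2 ?posrE; lra.
  have Lq : Q / (m * (m + 1)) <= q.
    rewrite /q ler_wpM2l// lef_pV2 ?posrE ?exprn_gt0// ?mulr_gt0//; last by lra.
    by rewrite expr2 ler_pM2l//; lra.
  have := divr_ge0 a0 (_ : 0 <= m + 1) => /(_ ltac:(lra)).
  have := divr_ge0 Q0 (_ : 0 <= m * (m + 1)) => /(_ ltac:(by rewrite mulr_ge0; lra)).
  by rewrite ler_norml /L; lra.
(* As [|L| <= a' + q <= 1], squaring does not increase [|L|], so [a'] and [q] enter the bound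
   unsquared. *)
have L2 : L ^+ 2 <= a' + q.
  have aq1 : a' + q <= 1 by have := sqr_ge0 F'; have := sqr_ge0 N'; lra.
  rewrite -(real_normK (num_real L)) expr2.
  by apply: (le_trans _ Lz); rewrite ler_piMr//; exact: le_trans Lz aq1.
have rL : (rho * L) ^+ 2 <= L ^+ 2 by rewrite exprMn ler_piMl ?sqr_ge0.
(* The squared denominator is at least [1 / 16] and the squared numerator at most [2 z], hence the
   constant 32. *)
have C2 : 1 / 16 <= ((Q + a) / (m + 1)) ^+ 2 by nra.
have F2 := sqr_ge0 F'; have N2 := sqr_ge0 N'.
have sq := sqr_ge0 (rho * L + N').
have num : (rho * L - N') ^+ 2 <= 2 * (N' ^+ 2 + F' ^+ 2 + a' + q).
  by nra.
apply: le_trans num _.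
have z0 : 0 <= N' ^+ 2 + F' ^+ 2 + a' + q by lra.
nra.
Qed.

(** * Coordinates of an ARH(1) process *)

Section coordinate_process.
Context (R : realType) (H : completeNormedModType R) (ip : {dot H for idfun}).
Hypothesis norm_ip : induces_norm ip.
Context (e : nat -> H) d (T : measurableType d) (P : probability T R).
Context (rho C : {linear H -> H}) (eps X : int -> T -> H).
Context (phi : nat -> H) (Cj rhoj : nat -> R).
Hypothesis arh1 : ARH1 ip P rho eps X.
Hypothesis A1 : autocovariance_assumption ip P e X C Cj phi.
Hypothesis A2 : autocorrelation_assumption ip e rho rhoj phi.
Local Notation intg f := (P.-integrable setT (EFin \o f)).
Local Notation E f := (Rintegral P setT f).
Local Notation L2 := (square_integrable P).

(** Each [rhoj j] is an eigenvalue at a unit vector, hence bounded by the operator norm. Uniformity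
    in [j] keeps [1 - rhoj j ^ 2] away from 0. *)
Lemma rhoj_bounded : exists2 r, 0 <= r < 1 & forall j, `|rhoj j| <= r.
Proof.
have onphi := autocov_orthonormal A1.
have rj j : (`|rhoj j|%:E <= opnorm rho)%E.
  apply: ereal_sup_ubound; exists (phi j); first by rewrite /= (orthonormal_norm norm_ip).
  rewrite (diagonal_eigen j onphi (autocorr_diagonal A2)) normrZ.
  by rewrite (orthonormal_norm norm_ip)// mulr1.
have op1 := arh1_opnorm arh1.
have op0 : (0%:E <= opnorm rho)%E by apply: le_trans (rj 0%N); rewrite lee_fin.
have opf : opnorm rho \is a fin_num by rewrite ge0_fin_numE// (lt_trans op1)// ltry.
exists (fine (opnorm rho)).
  by rewrite fine_ge0//= -lte_fin fineK.
by move=> j; rewrite -lee_fin fineK.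
Qed.

Variable j : nat.
Let c := Num.sqrt (Cj j).
(** The noise is divided by the same [c] as the process, and not by its own standard deviation as in
    [eta_tilde], so that the recursion keeps the coefficient [r]. *)
Let h (y : borel H) : R := ip y (phi j) / c.
Let x (i : nat) w := Defs.eta ip phi Cj X j i%:Z w.
Let r := rhoj j.
Let s2 := 1 - r ^+ 2.
(* Almost surely the normalised noise; this form makes the algebraic identities
   hold everywhere. *)
Let u i w := x i.+1 w - r * x i w.
Let past (i : nat) : set int := [set n | n <= i%:Z].

Let c_gt0 : 0 < c. Proof. by rewrite sqrtr_gt0 (autocov_gt0 A1). Qed.

Let sqr_r_lt1 : r ^+ 2 < 1.
Proof.
have [q /andP[q0 q1] /(_ j) rq] := rhoj_bounded.
rewrite -(real_normK (num_real r)) expr_lt1//; exact: le_lt_trans q1.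
Qed.

Lemma measurable_coordinate : measurable_fun setT h.
Proof.
apply: (measurability _ (RGenOInfty.measurableE R)).
move=> /= _ [_ [a ->]] <-; rewrite setTI.
apply: sub_sigma_algebra.
apply: (@open_comp _ _ (h : H -> R)) => //.
move=> y _; apply: cvgM; last exact: cvg_cst.
rewrite (ipC ip y); under eq_fun do rewrite ipC.
exact: continuous_ipr.
Qed.

Let noise := arh1_noise arh1.

Let measurable_h (Y : T -> H) : random_element Y -> measurable_fun setT (fun w => h (Y w)).
Proof.
move=> mY; apply: (@measurableT_comp _ _ _ _ (borel H) _ h _ Y); last exact: mY.
exact: measurable_coordinate.
Qed.

Let mx i : measurable_fun setT (x i).
Proof. exact: (measurable_h (arh1_measurable arh1 i%:Z)). Qed.

Let mu i : measurable_fun setT (u i).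
Proof. by apply: measurable_funB; [|apply: measurable_funM]. Qed.

(** Self-adjointness moves [rho] onto its eigenvector [phi j]; this makes each coordinate a scalar
    autoregression. *)
Let ip_rho y : ip (rho y) (phi j) = r * ip y (phi j).
Proof.
rewrite (autocorr_self_adjoint A2).
rewrite (diagonal_eigen j (autocov_orthonormal A1) (autocorr_diagonal A2)).
by rewrite ipZr.
Qed.

Let ip_iter_rho n y : ip (iter n rho y) (phi j) = r ^+ n * ip y (phi j).
Proof.
by elim: n => [|n IH]; rewrite ?expr0 ?mul1r//= ip_rho IH exprS mulrA.
Qed.

Let u_ae i : {ae P, forall w, u i w = h (eps i.+1%:Z w)}.
Proof.
apply: filterS (arh1_equation arh1 i.+1%:Z) => w.
have -> : i.+1%:Z - 1 = i%:Z by lia.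
rewrite /u /x /Defs.eta /coef_along => ->.
rewrite (ipC ip (_ + _)) linearD/= !(ipC ip (phi j)) ip_rho /h.
by rewrite mulrDl mulrA addrAC subrr add0r.
Qed.

(** Along [phi j] the stationary solution becomes the series of the [r ^+ k * h (eps (i - k))], an
    almost sure limit of functions of the noise up to time [i]. *)
Lemma coordinate_past_measurable i :
  past_measurable P eps (past i) (x i).
Proof.
apply: (past_measurable_cvg
  (f_ := fun m w => \sum_(k < m) r ^+ k * h (eps (i%:Z - k%:Z) w))).
  move=> m; apply: (past_measurable_sum (F := fun k w => _)) => k.
  apply: past_measurableM; first exact: past_measurable_cst.
  apply: past_measurable_coord; last exact: measurable_coordinate.
  by rewrite /past /=; lia.
apply: filterS (arh1_stationary_solution arh1 i%:Z) => w Xw.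
have hc : (fun m => ip (phi j) (\sum_(k < m) iter k rho (eps (i%:Z - k%:Z) w)) / c)
    @ \oo --> ip (phi j) (X i%:Z w) / c.
  by apply: cvgM; [exact: cvg_ipr|exact: cvg_cst].
rewrite /x /Defs.eta /coef_along ipC.
rewrite (_ : (fun m => _) = (fun m =>
  ip (phi j) (\sum_(k < m) iter k rho (eps (i%:Z - k%:Z) w)) / c))//.
apply/funext => m; rewrite ip_sumr mulr_suml; apply: eq_bigr => k _.
by rewrite (ipC ip (phi j)) ip_iter_rho mulrA.
Qed.

Let u_past i : past_measurable P eps (past i.+1) (u i).
Proof.
apply: past_measurableD; first exact: coordinate_past_measurable.
have -> : (fun w => - (r * x i w)) = (fun w => - r * x i w).
  by apply/funext => w; rewrite mulNr.
apply: past_measurableM; first exact: past_measurable_cst.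
apply: (@past_measurableS _ _ _ _ _ _ _ (past i)); last exact: coordinate_past_measurable.
by move=> n; rewrite /past /=; lia.
Qed.

Let mheps n : measurable_fun setT (fun w => h (eps n w)).
Proof. exact: measurable_h (swn_measurable noise n). Qed.

(** Almost surely [u i] is a function of [eps i.+1], which is independent of the noise up to time
    [i]. In the uses [k] is the identity, the square or the centred square. *)
Let innovation_mul i f (k : R -> R) : measurable_fun setT k ->
  measurable_fun setT f -> past_measurable P eps (past i) f ->
  intg f -> intg (fun w => k (u i w)) ->
  intg (fun w => f w * k (u i w)) /\
  E (fun w => f w * k (u i w)) = E f * E (fun w => k (u i w)).
Proof.
move=> mk mf pf intf intk.
have kuh : {ae P, forall w, k (u i w) = k (h (eps i.+1%:Z w))}.
  by apply: filterS (u_ae i) => w ->.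
have mku : measurable_fun setT (fun w => k (u i w)) by exact: measurableT_comp.
have mkh : measurable_fun setT (fun w => k (h (eps i.+1%:Z w))).
  by apply: (measurableT_comp mk); exact: mheps.
have [intkh Ekh] := integrable_ae_eq mku mkh kuh intk.
have past_i : ~ past i i.+1%:Z by rewrite /past /=; lia.
have [||||i1 e1] := past_integral_mul (swn_measurable noise)
  (swn_independent noise) (h := fun y => k (h y)) past_i pf => //.
  by apply: (measurableT_comp mk); exact: measurable_coordinate.
have efg : {ae P, forall w, f w * k (h (eps i.+1%:Z w)) = f w * k (u i w)}.
  by apply: filterS kuh => w ->.
have [i2 e2] := integrable_ae_eq (measurable_funM mf mkh) (measurable_funM mf mku) efg i1.
by split => //; rewrite -e2 e1 Ekh.
Qed.

(** Testing the expectation that defines [C (phi j)] against [phi j] gives [Cj j] as mean of the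
    squared coordinate; finiteness of this mean yields integrability. *)
Lemma coordinate_second_moment i : L2 (x i) /\ E (fun w => x i w ^+ 2) = 1.
Proof.
have [_ _ /(_ (phi j))] := autocov_def A1 i%:Z (phi j).
rewrite unlock (diagonal_eigen j (autocov_orthonormal A1) (autocov_diagonal A1)).
have -> : ip (Cj j *: phi j) (phi j) = Cj j.
  by rewrite ipC ipZr (autocov_orthonormal A1) eqxx mulr1.
have -> : (fun w => (ip (tensor ip (X i%:Z w) (X i%:Z w) (phi j)) (phi j))%:E) =
    (fun w => (c ^+ 2 * x i w ^+ 2)%:E).
  apply/funext => w; rewrite /tensor (ipC ip (_ *: _)) ipZr.
  rewrite (ipC ip (phi j)) /x /Defs.eta /coef_along.
  by rewrite expr_div_n -/c [in RHS]mulrC divfK ?expr2 ?mulf_eq0 ?gt_eqF//.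
move=> EX.
have intx : intg (fun w => c ^+ 2 * x i w ^+ 2).
  apply/integrableP; split.
    by apply/measurable_EFinP; apply: measurable_funM => //; exact: measurable_funX.
  rewrite [X in (X < _)%E](_ : _ = (Cj j)%:E) ?ltry// -EX.
  by apply: eq_integral => w _; rewrite /= ger0_norm// mulr_ge0 ?sqr_ge0.
have intx2 : intg (fun w => x i w ^+ 2).
  have := integrable_scale (c ^- 2) intx.
  by under eq_fun do rewrite mulKf ?expf_neq0 ?gt_eqF//.
split => //.
have c2 : c ^+ 2 = Cj j by rewrite sqr_sqrtr// ltW// (autocov_gt0 A1).
apply: (@mulfI _ (c ^+ 2)); first by rewrite expf_neq0 ?gt_eqF//.
by rewrite mulr1 -mean_scale// /Rintegral EX c2.
Qed.

Lemma innovation_mean i : intg (u i) /\ E (u i) = 0.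
Proof.
have [_ intn Em] := swn_mean noise i.+1%:Z.
have inth : intg (fun w => h (eps i.+1%:Z w)).
  apply: integrable_le (integrable_scale c^-1 intn) _; first exact: mheps.
  have c'0 : 0 <= c^-1 by rewrite invr_ge0 ltW.
  move=> w; rewrite /h normrM (ger0_norm c'0) mulrC.
  apply: ler_wpM2l => //; apply: le_trans (ip_cauchy norm_ip _ _) _.
  by rewrite (orthonormal_norm norm_ip _ (autocov_orthonormal A1)) mulr1.
have hu : {ae P, forall w, h (eps i.+1%:Z w) = u i w}.
  by apply: filterS (u_ae i) => w ->.
have [iu eu] := integrable_ae_eq (mheps _) (mu i) hu inth.
split => //; rewrite -eu.
have := Em (phi j); rewrite unlock ipC linear0 => E0.
have intip : intg (fun w => ip (eps i.+1%:Z w) (phi j)).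
  have := integrable_scale c inth.
  by under eq_fun do rewrite /h mulrC divfK ?gt_eqF//.
rewrite /h; under eq_Rintegral do rewrite mulrC.
by rewrite mean_scale// /Rintegral E0 mulr0.
Qed.

(** In the mean of the squared recursion the cross term vanishes by independence, leaving
    [1 = r ^ 2 + E u ^ 2]. *)
Lemma innovation_sqr i : L2 (u i) /\ E (fun w => u i w ^+ 2) = s2.
Proof.
have [Lx Ex] := coordinate_second_moment i; have [Lx1 Ex1] := coordinate_second_moment i.+1.
have Lu : L2 (u i) by apply: L2B => //; exact: L2Z.
split => //.
have [iu Eu] := innovation_mean i.
have [ixu Exu] := innovation_mul (k := id) (@measurable_id _ _ _) (mx i)
  (coordinate_past_measurable i) (L2_int Lx) iu.
have [_ ix] := Lx; have [_ iu2] := Lu.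
have : E (fun w => x i.+1 w ^+ 2) =
    E (fun w => r ^+ 2 * x i w ^+ 2 + (2 * r * (x i w * u i w) + u i w ^+ 2)).
  by apply: eq_Rintegral => w _; rewrite /u; ring.
have i1 : intg (fun w => 2 * r * (x i w * u i w)) by exact: integrable_scale.
rewrite mean_add//; [|exact: integrable_scale|exact: integrable_add].
by rewrite mean_add// !mean_scale// Ex Ex1 Exu Eu /s2; lra.
Qed.

(** The variables [h (eps i.+1)] share one law; nonnegativity of [k] allows the change of variables
    to it. *)
Lemma innovation_identically_distributed i (k : R -> R) :
  measurable_fun setT k -> (forall y, 0 <= k y) ->
  E (fun w => k (u i w)) = E (fun w => k (u 0%N w)).
Proof.
move=> mk k0.
have mkh : measurable_fun [set: borel H] (fun y => (k (h y))%:E).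
  by apply/measurable_EFinP; apply: (measurableT_comp mk); exact: measurable_coordinate.
have law i' : E (fun w => k (u i' w)) = fine (\int[P]_w (k (h (eps i'.+1%:Z w)))%:E).
  congr fine; apply: ae_eq_integral => //.
  - by apply/measurable_EFinP; apply: measurableT_comp.
  - by apply/measurable_EFinP; apply: (measurableT_comp mk); exact: mheps.
  - by apply: filterS (u_ae i') => w -> _.
rewrite !law; congr fine.
pose Y n : {mfun T >-> borel H} := mfun_Sub (mem_set (swn_measurable noise n)).
have Yi n : (\int[P]_w (k (h (eps n w)))%:E =
    \int[distribution P (Y n)]_y (k (h y))%:E)%E.
  by rewrite ge0_integral_distribution// => y; rewrite lee_fin.
rewrite !Yi; apply: eq_measure_integral => A mA _.
exact: (swn_identically_distributed noise).
Qed.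

Hypothesis fourth_moment : forall n : int,
  ('E_P[fun w => (eta_tilde ip phi Cj rhoj eps j n w ^+ 4)%R] < +oo)%E.

Lemma innovation_kurtosis i : L2 (fun w => u i w ^+ 2 - s2).
Proof.
apply: L2B; last exact: L2_cst.
split; first exact: measurable_funX.
have s2_gt0 : 0 < s2 by rewrite subr_gt0.
(* The denominator in [eta_tilde] is [c * sqrt s2], so its fourth moment is that of [h (eps _)] up
   to the factor [s2 ^ 2]. *)
have tE w : eta_tilde ip phi Cj rhoj eps j i.+1%:Z w =
    (Num.sqrt s2)^-1 * h (eps i.+1%:Z w).
  rewrite /eta_tilde /h /coef_along sqrtrM ?ltW// ?(autocov_gt0 A1)//.
  by rewrite invfM mulrC -mulrA mulrC -mulrA mulrCA.
have mt : measurable_fun setT (fun w => eta_tilde ip phi Cj rhoj eps j i.+1%:Z w ^+ 4).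
  apply: measurable_funX; rewrite (funext tE).
  by apply: measurable_funM => //; exact: mheps.
have it : intg (fun w => eta_tilde ip phi Cj rhoj eps j i.+1%:Z w ^+ 4).
  apply/integrableP; split; first exact/measurable_EFinP.
  have := fourth_moment i.+1%:Z; rewrite unlock; apply: le_lt_trans.
  rewrite le_eqVlt; apply/orP; left; apply/eqP/eq_integral => w _.
  by rewrite /= ger0_norm// (exprM _ 2 2) sqr_ge0.
have := integrable_scale (s2 ^+ 2) it.
have s2sq : (Num.sqrt s2) ^+ 4 = s2 ^+ 2 by rewrite (exprM _ 2 2) sqr_sqrtr// ltW.
have sn0 : Num.sqrt s2 != 0 by rewrite gt_eqF// sqrtr_gt0.
under eq_fun do rewrite tE exprMn exprVn -s2sq mulVKf ?expf_neq0//.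
move=> ih; suff [] : intg (fun w => (u i w ^+ 2) ^+ 2) /\
  E (fun w => h (eps i.+1%:Z w) ^+ 4) = E (fun w => (u i w ^+ 2) ^+ 2) by [].
apply: integrable_ae_eq ih.
- by apply: measurable_funX; exact: mheps.
- by do 2 apply: measurable_funX; exact: mu.
- by apply: filterS (u_ae i) => w ->; rewrite (exprM _ 2 2).
Qed.

(** By independence the mean of [x i ^ 2 * u i ^ 2] factors as [1 * s2]. *)
Let xu_mul i : L2 (fun w => x i w * u i w) /\
  E (fun w => (x i w * u i w) ^+ 2) = s2.
Proof.
have [Lx Ex] := coordinate_second_moment i; have [Lu Eu] := innovation_sqr i.
have [_ ix2] := Lx; have [_ iu2] := Lu.
have px2 : past_measurable P eps (past i) (fun w => x i w ^+ 2).
  under eq_fun do rewrite expr2.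
  by apply: past_measurableM; exact: coordinate_past_measurable.
have [i1 e1] := innovation_mul (k := fun y => y ^+ 2)
  (measurable_funX _ (@measurable_id _ _ _)) (measurable_funX 2 (mx i)) px2 ix2 iu2.
have sq : (fun w => (x i w * u i w) ^+ 2) = (fun w => x i w ^+ 2 * u i w ^+ 2).
  by apply/funext => w; rewrite exprMn.
split; first by split; [exact: measurable_funM|rewrite sq].
by rewrite sq e1 Ex Eu mul1r.
Qed.

(** The factor [x i * u i * x l] depends only on the noise up to time [l], while [u l] is centred
    and independent of it. *)
Let xu_orthogonal i l : (i < l)%N ->
  E (fun w => x i w * u i w * (x l w * u l w)) = 0.
Proof.
move=> il.
have [Lxu _] := xu_mul i; have [Lx _] := coordinate_second_moment l.
have [iu Eu] := innovation_mean l.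
have sub : past i.+1 `<=` past l by move=> n; rewrite /past /=; lia.
have sub' : past i `<=` past l by move=> n; rewrite /past /=; lia.
have pf : past_measurable P eps (past l) (fun w => x i w * u i w * x l w).
  apply: past_measurableM; last exact: coordinate_past_measurable.
  apply: past_measurableM.
    by apply: (past_measurableS sub'); exact: coordinate_past_measurable.
  by apply: (past_measurableS sub); exact: u_past.
have mf : measurable_fun setT (fun w => x i w * u i w * x l w).
  by do 2 apply: measurable_funM => //.
have [_ e1] := innovation_mul (k := id) (@measurable_id _ _ _) mf pf
  (L2_mul Lxu Lx) iu.
by under eq_Rintegral do rewrite mulrA; rewrite e1 Eu mulr0.
Qed.

Let centered_sqr_orthogonal i l : (i < l)%N ->
  E (fun w => (u i w ^+ 2 - s2) * (u l w ^+ 2 - s2)) = 0.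
Proof.
move=> il.
have sub : past i.+1 `<=` past l by move=> n; rewrite /past /=; lia.
have pf : past_measurable P eps (past l) (fun w => u i w ^+ 2 - s2).
  apply: past_measurableD; last exact: past_measurable_cst.
  under eq_fun do rewrite expr2.
  by apply: past_measurableM; apply: (past_measurableS sub); exact: u_past.
have [mf _] := innovation_kurtosis i.
have [Lu Eu] := innovation_sqr l.
have iul : intg (fun w => u l w ^+ 2 - s2) by exact: L2_int (innovation_kurtosis l).
have mk : measurable_fun setT (fun y : R => y ^+ 2 - s2).
  by apply: measurable_funB => //; exact: measurable_funX.
have [_ e1] := innovation_mul mk mf pf (L2_int (innovation_kurtosis i)) iul.
rewrite e1; have [_ iu2] := Lu.
rewrite (mean_add iu2 (integrable_const P (- s2))) Eu mean_const.
by rewrite subrr mulr0.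
Qed.

Let sqr_expectation_le (G : T -> R) (b : R) : measurable_fun setT G ->
  ('E_P[fun w => (G w ^+ 2)%R] <= b%:E)%E ->
  L2 G /\ E (fun w => G w ^+ 2) <= b.
Proof.
move=> mG; rewrite unlock => EG.
have iG : intg (fun w => G w ^+ 2).
  apply/integrableP; split; first by apply/measurable_EFinP; exact: measurable_funX.
  apply: le_lt_trans (ltry b); apply: le_trans EG.
  rewrite le_eqVlt; apply/orP; left; apply/eqP/eq_integral => w _.
  by rewrite /= ger0_norm// sqr_ge0.
split => //; rewrite -lee_fin /Rintegral fineK//.
exact: (integrable_fin_num measurableT iG).
Qed.

Context (K : R).
Hypothesis moment : \forall n \near \oo,
  ('E_P[fun w => ((1 - n%:R^-1 *
        \sum_(i < n) Defs.eta ip phi Cj X j i%:Z w ^+ 2) ^+ 2)%R] <= (K / n%:R)%:E)%E.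

(** The centred sum is [- n] times the deviation in [moment], which turns the bound [K / n] into
    [n * K]. *)
Let centered_sum_moment : \forall n \near \oo,
  L2 (fun w => \sum_(i < n) (x i w ^+ 2 - 1)) /\
  E (fun w => (\sum_(i < n) (x i w ^+ 2 - 1)) ^+ 2) <= n%:R * K.
Proof.
have := nbhs_infty_gt 0; apply: filterS2 moment => n EG n0.
have nR0 : n%:R != 0 :> R by rewrite pnatr_eq0 -lt0n.
pose G w := 1 - n%:R^-1 * \sum_(i < n) x i w ^+ 2.
have SG w : \sum_(i < n) (x i w ^+ 2 - 1) = - n%:R * G w.
  rewrite /G sumrB sumr_const card_ord.
  by move: (\sum_(i < n) _) => Q; field.
have mG : measurable_fun setT G.
  apply: measurable_funB => //; apply: measurable_funM => //.
  by apply: measurable_sum => i; exact: measurable_funX.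
have [LG {}EG] := sqr_expectation_le mG EG.
 rewrite (funext SG); split; first exact: L2Z.
have [_ iG] := LG.
under eq_Rintegral do rewrite SG exprMn sqrrN.
rewrite mean_scale//; apply: le_trans (ler_wpM2l _ EG) _; first exact: sqr_ge0.
by rewrite expr2 mulrACA divff// mulr1.
Qed.

(** The rank in [moment] leaves no trace in the bound: the left side does not depend on [i], so it
    can be estimated over one window taken beyond that rank. *)
Lemma innovation_kurtosis_le i :
  E (fun w => (u i w ^+ 2 - s2) ^+ 2) <= 40 * K + 20.
Proof.
have w_const l : E (fun w => (u l w ^+ 2 - s2) ^+ 2) = E (fun w => (u 0%N w ^+ 2 - s2) ^+ 2).
  apply: (@innovation_identically_distributed l (fun y => (y ^+ 2 - s2) ^+ 2)).
    by apply: measurable_funX; apply: measurable_funB => //; exact: measurable_funX.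
  by move=> y; exact: sqr_ge0.
rewrite w_const; apply: (@noise_kurtosis_le _ _ _ P x r) => //.
- exact: ltW.
- by move=> l; have [] := xu_mul l.
- by move=> l; have [] := xu_mul l.
- exact: innovation_kurtosis.
Qed.

Lemma cross_sum_moment n :
  L2 (fun w => \sum_(i < n) (x i w * u i w)) /\
  E (fun w => (\sum_(i < n) (x i w * u i w)) ^+ 2) <= n%:R.
Proof.
have Lxu l : L2 (fun w => x l w * u l w) by have [] := xu_mul l.
split; first exact: (@L2_sum _ _ _ _ n (fun i w => x i w * u i w)).
rewrite (@orthogonal_sum _ _ _ _ n (fun i w => x i w * u i w) s2)//.
  by rewrite ler_piMr// /s2 gerBl sqr_ge0.
by move=> l; have [] := xu_mul l.
Qed.

Lemma centered_sqr_sum_moment n :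
  L2 (fun w => \sum_(i < n) (u i w ^+ 2 - s2)) /\
  E (fun w => (\sum_(i < n) (u i w ^+ 2 - s2)) ^+ 2) <= n%:R * (40 * K + 20).
Proof.
have L l : L2 (fun w => u l w ^+ 2 - s2) by exact: innovation_kurtosis.
split; first exact: (@L2_sum _ _ _ _ n (fun i w => u i w ^+ 2 - s2)).
rewrite (@orthogonal_sum _ _ _ _ n (fun i w => u i w ^+ 2 - s2)
  (E (fun w => (u 0%N w ^+ 2 - s2) ^+ 2)))//.
  by rewrite ler_wpM2l// innovation_kurtosis_le.
move=> l; apply: (@innovation_identically_distributed l (fun y => (y ^+ 2 - s2) ^+ 2)).
  by apply: measurable_funX; apply: measurable_funB => //; exact: measurable_funX.
by move=> y; exact: sqr_ge0.
Qed.

End coordinate_process.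

Lemma measurable_funV (R : realType) : measurable_fun setT (@GRing.inv R).
Proof.
rewrite -(setvU [set 0]); apply/measurable_funU => //; first exact: measurableC.
split; last exact: measurable_fun_set1.
apply: open_continuous_measurable_fun; last first.
  by move=> y; rewrite inE => /eqP; exact: inv_continuous.
by apply/closed_openC/accessible_closed_set1/hausdorff_accessible/norm_hausdorff.
Qed.

(** * Estimation error of a single coordinate *)

Section error_term.
Context (R : realType).

(** The quantity [z] of [ratio_estimate], as a function of a path. *)
Definition error_term (x : nat -> R) (r : R) (m : nat) : R :=
  let u i := x i.+1 - r * x i in
  ((\sum_(i < m) x i * u i) / m%:R) ^+ 2 +
  ((\sum_(i < m) (u i ^+ 2 - (1 - r ^+ 2))) / m%:R) ^+ 2 +
  x m ^+ 2 / m%:R + (\sum_(i < m) x i ^+ 2) / m%:R ^+ 2.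

Lemma error_term_ge0 x r m : 0 <= error_term x r m.
Proof.
apply: addr_ge0; last by rewrite divr_ge0 ?sumr_ge0// => *; exact: sqr_ge0.
by apply: addr_ge0; [apply: addr_ge0; exact: sqr_ge0|rewrite divr_ge0 ?sqr_ge0].
Qed.

Lemma autoregression_ratio x r s m : (0 < m)%N -> 0 < s -> s <= 1 - r ^+ 2 ->
  error_term x r m <= (s / 8) ^+ 2 ->
  (r - (m%:R^-1 * \sum_(i < m) x i * x i.+1) /
       (m.+1%:R^-1 * \sum_(i < m.+1) x i ^+ 2)) ^+ 2 <= 32 * error_term x r m.
Proof.
move=> m0 s0 sr.
have m1 : 1 <= m%:R :> R by rewrite ler1n.
have Q0 : 0 <= \sum_(i < m) x i ^+ 2 by apply: sumr_ge0 => *; exact: sqr_ge0.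
set N := \sum_(i < m) x i * (x i.+1 - r * x i).
set F := \sum_(i < m) ((x i.+1 - r * x i) ^+ 2 - (1 - r ^+ 2)).
(* Telescoping of the squared recursion, with boundary terms [x m ^ 2] and [x 0 ^ 2]. *)
have eQ : (1 - r ^+ 2) * (\sum_(i < m) x i ^+ 2) =
    m%:R * (1 - r ^+ 2) + F + 2 * r * N - x m ^+ 2 + x 0%N ^+ 2.
  rewrite {}/F {}/N; elim: (m) => [|p IH]; first by rewrite !big_ord0; ring.
  by rewrite !big_ord_recr /= mulrDr IH -natr1; ring.
have -> : \sum_(i < m) x i * x i.+1 = r * (\sum_(i < m) x i ^+ 2) + N.
  by rewrite /N mulr_sumr -big_split; apply: eq_bigr => i _ /=; ring.
rewrite big_ord_recr /= (mulrC m%:R^-1) (mulrC m.+1%:R^-1) -[m.+1%:R]natr1.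
move=> zs; rewrite /error_term.
exact: (ratio_estimate m1 s0 sr Q0 (sqr_ge0 (x m)) (sqr_ge0 (x 0%N)) eQ zs).
Qed.

End error_term.

Section estimation_error.
Context (R : realType) (H : completeNormedModType R) (ip : {dot H for idfun}).
Hypothesis norm_ip : induces_norm ip.
Context (e : nat -> H) d (T : measurableType d) (P : probability T R).
Context (rho C : {linear H -> H}) (eps X : int -> T -> H).
Context (phi : nat -> H) (Cj rhoj : nat -> R).
Hypothesis arh1 : ARH1 ip P rho eps X.
Hypothesis A1 : autocovariance_assumption ip P e X C Cj phi.
Hypothesis A2 : autocorrelation_assumption ip e rho rhoj phi.
Hypothesis fourth_moment : forall (j : nat) (n : int),
  ('E_P[fun w => (eta_tilde ip phi Cj rhoj eps j n w ^+ 4)%R] < +oo)%E.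
Local Notation intg f := (P.-integrable setT (EFin \o f)).
Local Notation E f := (Rintegral P setT f).
Local Notation L2 := (square_integrable P).
Let x j i w := Defs.eta ip phi Cj X j i%:Z w.

(** The four terms contribute at most [1 / m], [(40 K + 20) / m], [1 / m] and [1 / m]. The bound
    holds at every positive [m], however late the rank in the hypothesis. *)
Lemma error_term_moment j K m : (0 < m)%N ->
  (\forall n \near \oo, ('E_P[fun w => ((1 - n%:R^-1 *
        \sum_(i < n) Defs.eta ip phi Cj X j i%:Z w ^+ 2) ^+ 2)%R] <= (K / n%:R)%:E)%E) ->
  intg (fun w => error_term (fun i => x j i w) (rhoj j) m) /\
  E (fun w => error_term (fun i => x j i w) (rhoj j) m) <= (40 * K + 23) / m%:R.
Proof.
move=> m0 moment.
have mR : 0 < m%:R :> R by rewrite ltr0n.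
have Lx i : L2 (x j i) by have [] := coordinate_second_moment norm_ip arh1 A1 j i.
have Ex i : E (fun w => x j i w ^+ 2) = 1.
  by have [] := coordinate_second_moment norm_ip arh1 A1 j i.
have ix i : intg (fun w => x j i w ^+ 2) by have [] := Lx i.
have [[_ iN] EN] := cross_sum_moment norm_ip arh1 A1 A2 j m.
have [[_ iF] EF] := centered_sqr_sum_moment norm_ip arh1 A1 A2 (fourth_moment j) moment m.
have iQ : intg (fun w => \sum_(i < m) x j i w ^+ 2).
  by apply: (@integrable_ord_sum _ _ _ _ m (fun i w => x j i w ^+ 2)).
have EQ : E (fun w => \sum_(i < m) x j i w ^+ 2) = m%:R.
  rewrite (@mean_sum _ _ _ _ m (fun i w => x j i w ^+ 2))//.
  by under eq_bigr do rewrite Ex; rewrite sumr_const card_ord.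
have zE : (fun w => error_term (fun i => x j i w) (rhoj j) m) = (fun w =>
    (m%:R ^+ 2)^-1 * (\sum_(i < m) (x j i w * (x j i.+1 w - rhoj j * x j i w))) ^+ 2 +
    ((m%:R ^+ 2)^-1 * (\sum_(i < m) ((x j i.+1 w - rhoj j * x j i w) ^+ 2 -
        (1 - rhoj j ^+ 2))) ^+ 2 +
    (m%:R^-1 * x j m w ^+ 2 + (m%:R ^+ 2)^-1 * \sum_(i < m) x j i w ^+ 2))).
  apply/funext => w; rewrite /error_term !expr_div_n !addrA.
  by rewrite ![_ / _]mulrC.
rewrite zE.
have i1 := integrable_scale (m%:R ^+ 2)^-1 iN.
have i2 := integrable_scale (m%:R ^+ 2)^-1 iF.
have i3 := integrable_scale m%:R^-1 (ix m).
have i4 := integrable_scale (m%:R ^+ 2)^-1 iQ.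
have i34 := integrable_add i3 i4; have i234 := integrable_add i2 i34.
split; first exact: integrable_add.
rewrite mean_add// mean_add// mean_add// !mean_scale// Ex EQ.
have m2 : 0 < (m%:R ^+ 2)^-1 :> R by rewrite invr_gt0 exprn_gt0.
have h1 := ler_wpM2l (ltW m2) EN; have h2 := ler_wpM2l (ltW m2) EF.
apply: le_trans (lerD h1 (lerD h2 (lexx _))) _.
rewrite le_eqVlt; apply/orP; left; apply/eqP; field.
by rewrite gt_eqF.
Qed.

(** The factor [c ^ 2] between raw and normalised coordinates cancels in the ratio. A sample of size
    [m.+1] has [m] products of neighbours. *)
Lemma rho_hat_error j s m w : (0 < m)%N -> 0 < s -> s <= 1 - rhoj j ^+ 2 ->
  error_term (fun i => x j i w) (rhoj j) m <= (s / 8) ^+ 2 ->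
  (rhoj j - rho_hat ip phi X m.+1 j w) ^+ 2 <=
  32 * error_term (fun i => x j i w) (rhoj j) m.
Proof.
move=> m0 s0 sr /(autoregression_ratio m0 s0 sr).
have c0 : 0 < Cj j by exact: autocov_gt0 A1 j.
set c := Num.sqrt (Cj j).
have cn0 : c != 0 by rewrite gt_eqF// sqrtr_gt0.
suff -> : rho_hat ip phi X m.+1 j w = (m%:R^-1 * \sum_(i < m) x j i w * x j i.+1 w) /
       (m.+1%:R^-1 * \sum_(i < m.+1) x j i w ^+ 2) by [].
have xE i : coef_along ip phi X i%:Z j w = c * x j i w.
  by rewrite /x /Defs.eta mulrC divfK.
rewrite /rho_hat /D_hat /C_hat /=.
have -> : \sum_(i < m) coef_along ip phi X i%:Z j w * coef_along ip phi X i.+1%:Z j w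
    = c ^+ 2 * \sum_(i < m) x j i w * x j i.+1 w.
  by rewrite mulr_sumr; apply: eq_bigr => i _; rewrite !xE; ring.
have -> : \sum_(i < m.+1) coef_along ip phi X i%:Z j w ^+ 2 =
    c ^+ 2 * \sum_(i < m.+1) x j i w ^+ 2.
  by rewrite mulr_sumr; apply: eq_bigr => i _; rewrite !xE; ring.
rewrite ![_^-1 * (c ^+ 2 * _)]mulrCA -mulf_div divff ?mul1r//.
by rewrite expf_neq0.
Qed.

Lemma measurable_rho_hat n j : measurable_fun setT (rho_hat ip phi X n j).
Proof.
have c0 : 0 < Cj j by exact: autocov_gt0 A1 j.
have mc i : measurable_fun setT (coef_along ip phi X i%:Z j).
  have [[mx _] _] := coordinate_second_moment norm_ip arh1 A1 j i.
  rewrite [X in measurable_fun _ X](_ : _ = fun w => Num.sqrt (Cj j) * x j i w).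
    exact: measurable_funM.
  by apply/funext => w; rewrite /x /Defs.eta mulrC divfK// gt_eqF// sqrtr_gt0.
apply: measurable_funM.
  apply: measurable_funM => //; apply: measurable_sum => i.
  exact: measurable_funM.
apply: (measurableT_comp (@measurable_funV R)).
apply: measurable_funM => //; apply: measurable_sum => i.
exact: measurable_funX.
Qed.

End estimation_error.

(** * Convergence in probability *)

(** By monotonicity [n * c n.-1] is at most a partial sum of the series, hence at most its limit. *)
Lemma summable_index_bound (R : realType) (c : nat -> R) :
  (forall i j, (i <= j)%N -> c j <= c i) -> (forall j, 0 < c j) ->
  cvgn (series c) ->
  exists2 M, 0 < M & forall n, (0 < n)%N -> n%:R * c n.-1 <= M.
Proof.
move=> cdec c0 cc; exists (limn (series c)).
  have : series c 1%N <= limn (series c).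
    apply: nondecreasing_cvgn_le => //.
    by apply: nondecreasing_series => i _ _; exact: ltW.
  by apply: lt_le_trans; rewrite /series/= big_nat1.
case=> // n _; apply: (@le_trans _ _ (series c n.+1)).
  rewrite /series /= big_mkord mulrC mulr_natr -[X in _ *+ X]card_ord -sumr_const.
  by apply: ler_sum => i _; apply: cdec; rewrite -ltnS.
apply: nondecreasing_cvgn_le => //.
by apply: nondecreasing_series => i _ _; exact: ltW.
Qed.

(** The product [k n * c (k n).-1] is bounded, while [n * c (k n).-1] tends to infinity since it
    dominates [sqrt n * c (k n).-1]. *)
Lemma truncation_sublinear (R : realType) (c : nat -> R) (k : nat -> nat) :
  (forall i j, (i <= j)%N -> c j <= c i) -> (forall j, 0 < c j) ->
  cvgn (series c) -> (forall n, (2 <= n)%N -> (0 < k n < n)%N) ->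
  (fun n : nat => c (k n).-1 * Num.sqrt (n%:R : R)) @ \oo --> +oo ->
  (fun n => (k n)%:R / (n.-1)%:R : R) @ \oo --> 0.
Proof.
move=> cdec c0 cc kb cy.
have [M M0 cM] := summable_index_bound cdec c0 cc.
apply/cvgr0Pnorm_le => eps eps0.
(* The factor 2 pays for [n <= 2 * n.-1]. *)
move/cvgryPge : cy => /(_ (2 * M / eps)) cy.
have := nbhs_infty_ge 2; apply: filterS2 cy => n cn n2.
have /andP[k0 _] := kb n n2.
have n1 : (0 < n.-1)%N by lia.
have nR : n%:R <= 2 * (n.-1)%:R :> R by rewrite -natrM ler_nat; lia.
have nR1 : 1 <= (n.-1)%:R :> R by rewrite ler1n.
rewrite ger0_norm ?divr_ge0// ler_pdivrMr; last by lra.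
have kM := cM (k n) k0.
have s1 : Num.sqrt n%:R <= n%:R :> R.
  have n0 : 1 <= n%:R :> R by rewrite ler1n; lia.
  rewrite -ler_sqr ?nnegrE ?sqrtr_ge0 ?sqr_sqrtr ?ler0n//.
  by rewrite expr2 ler_peMr// ltW// (lt_le_trans _ n0).
have h1 : c (k n).-1 * Num.sqrt n%:R <= c (k n).-1 * (2 * (n.-1)%:R).
  by rewrite ler_pM2l//; exact: le_trans nR.
have h2 : 2 * M / eps <= c (k n).-1 * (2 * (n.-1)%:R) by exact: le_trans cn h1.
have h3 : M <= c (k n).-1 * (n.-1)%:R * eps.
  by move: h2; rewrite ler_pdivrMr//; lra.
rewrite -(ler_pM2r (c0 (k n).-1)); apply: le_trans kM _; lra.
Qed.

Lemma markov_ge0 (R : realType) d (T : measurableType d) (P : probability T R)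
    (Z : T -> R) (c : R) : 0 < c -> measurable_fun setT Z ->
  P.-integrable setT (EFin \o Z) -> (forall w, 0 <= Z w) ->
  (P [set w | (c <= Z w)%R] <= (c^-1 * Rintegral P setT Z)%:E)%E.
Proof.
move=> c0 mZ iZ Z0.
pose Zm : {mfun T >-> R} := mfun_Sub (mem_set mZ).
have := @markov _ _ _ P Zm id c c0 (@measurable_id _ _ _) (fun _ => id) _.
rewrite (_ : [set x | (c%:E <= `|(Zm x)%:E|)%E] = [set w | c <= Z w]); last first.
  by apply/seteqP; split => w /=; rewrite lee_fin ger0_norm.
have -> : ('E_P[id \o (fun y : R => `|y|)%R \o Zm] = (Rintegral P setT Z)%:E)%E.
  rewrite unlock /Rintegral fineK; last exact: (integrable_fin_num measurableT iZ).
  by apply: eq_integral => w _ /=; rewrite ger0_norm.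
by rewrite EFinM lee_pdivlMl//; apply.
Qed.

Lemma summable_sqr_tail (R : realType) (a : nat -> R) : cvgn (series (fun j => a j ^+ 2)) ->
  exists2 t : nat -> R, (forall n, (\sum_(n <= j <oo) (a j ^+ 2)%:E)%E = (t n)%:E) &
    t @ \oo --> 0.
Proof.
move=> ca.
have a0 j : (0 <= (a j ^+ 2)%:E)%E by rewrite lee_fin sqr_ge0.
have sumoo : (\sum_(0 <= j <oo) (a j ^+ 2)%:E < +oo)%E.
  have -> : (\sum_(0 <= j <oo) (a j ^+ 2)%:E)%E = (limn (series (fun j => a j ^+ 2)))%:E.
    apply: cvg_sqr_nneseries; move: ca; rewrite /series /=.
    by under eq_fun do rewrite big_mkord.
  exact: ltry.
have tfin n : (\sum_(n <= j <oo) (a j ^+ 2)%:E)%E \is a fin_num.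
  rewrite ge0_fin_numE; last exact: nneseries_ge0.
  apply: le_lt_trans sumoo; rewrite (nneseries_split 0 n)//.
  by rewrite add0n leeDr// sume_ge0.
exists (fun n => fine (\sum_(n <= j <oo) (a j ^+ 2)%:E)%E).
  by move=> n; rewrite fineK.
apply: fine_cvg; apply: (@nneseries_tail_cvg _ _ xpredT) => //.
Qed.

(** The error is diagonal in [phi]; its entries from [k n] on are the [rhoj j], whose squares sum to
    the truncation bias [t (k n)]. *)
Lemma hs_norm_error (R : realType) (H : completeNormedModType R)
    (ip : {dot H for idfun}) (norm_ip : induces_norm ip) (e : nat -> H)
    (basis_e : orthonormal_basis ip e) d (T : measurableType d)
    (rho : {linear H -> H}) (X : int -> T -> H) (phi : nat -> H)
    (rhoj : nat -> R) (k : nat -> nat) (onphi : orthonormal_system ip phi)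
    (rho_diag : diagonal_in ip phi rhoj rho) n w (t : nat -> R) :
  (forall n, (\sum_(n <= j <oo) (rhoj j ^+ 2)%:E)%E = (t n)%:E) ->
  hs_norm e (fun x => rho x - rho_hat_op ip phi X k n w x) =
  (Num.sqrt (\sum_(j < k n) (rhoj j - rho_hat ip phi X n j w) ^+ 2 + t (k n)))%:E.
Proof.
move=> tE.
have t0 m : 0 <= t m by rewrite -lee_fin -tE nneseries_ge0// => *; rewrite lee_fin sqr_ge0.
rewrite (diagonal_hs_norm norm_ip basis_e onphi
  (@diagonal_sub _ _ ip _ _ (fun j => rho_hat ip phi X n j w) (k n) _ rho_diag)).
rewrite (nneseries_split 0 (k n)); last by move=> *; rewrite lee_fin sqr_ge0.
rewrite add0n big_mkord.
have -> : (\sum_(k n <= j <oo) ((rhoj j -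
    (if (j < k n)%N then rho_hat ip phi X n j w else 0)) ^+ 2)%:E)%E = (t (k n))%:E.
  rewrite -tE; congr (limn _); apply/funext => p; apply: eq_big_nat => j /andP[kj _].
  by rewrite ltnNge kj subr0.
under eq_bigr do rewrite ltn_ord.
rewrite sumEFin -EFinD poweR_EFin powR12_sqrt//.
by apply: addr_ge0 => //; apply: sumr_ge0 => *; exact: sqr_ge0.
Qed.

Theorem corollary1 (R : realType)
  (H : completeNormedModType R) (ip : {dot H for idfun})
  (norm_ip : induces_norm ip) (sepH : separable H)
  (e : nat -> H) (basis_e : orthonormal_basis ip e)
  (d : measure_display) (T : measurableType d) (P : probability T R)
  (rho C : {linear H -> H}) (eps X : int -> T -> H)
  (phi : nat -> H) (Cj rhoj K1 K2 : nat -> R) (k : nat -> nat)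
  (arh1 : ARH1 ip P rho eps X)
  (A1 : autocovariance_assumption ip P e X C Cj phi)
  (A2 : autocorrelation_assumption ip e rho rhoj phi)
  (fourth_moment : forall (j : nat) (n : int),
    ('E_P[fun w => (eta_tilde ip phi Cj rhoj eps j n w ^+ 4)%R] < +oo)%E)
  (k_bounds : forall n, (2 <= n)%N -> (0 < k n < n)%N)
  (k_infty : k @ \oo --> \oo)
  (A3 : (fun n : nat => Cj (k n).-1 * Num.sqrt (n%:R : R)) @ \oo --> +oo)
  (A4 : moment_assumption ip P phi Cj rhoj X K1 K2) :
  cvg0_in_probability P
    (fun n w => hs_norm e (fun x => rho x - rho_hat_op ip phi X k n w x)).
Proof.
move=> delta delta0.
have [q /andP[q0 q1] rq] := rhoj_bounded norm_ip arh1 A1 A2.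
have [t tE t0] := summable_sqr_tail (autocorr_summable A2).
have [S KS] := moment_sup A4.
have KS1 j : K1 j <= S.
  apply: le_trans (KS _ (ex_intro2 _ _ j I erefl)).
  by rewrite lerDl ltW// (moment_K2_gt0 A4).
pose s := 1 - q ^+ 2.
have s0 : 0 < s by rewrite subr_gt0 expr_lt1.
have sr j : s <= 1 - rhoj j ^+ 2.
  by rewrite lerD2l lerN2 -(real_normK (num_real (rhoj j))) ler_sqr ?nnegrE.
(* When the sum of the error terms is below [c], the first bound makes [rho_hat_error] applicable to
   every coordinate, and the second keeps 32 times the sum below [delta ^ 2 / 2]. *)
pose c := Num.min ((s / 8) ^+ 2) (delta ^+ 2 / 64).
have c0 : 0 < c by rewrite lt_min exprn_gt0 ?divr_gt0 ?exprn_gt0.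
pose W := 40 * S + 23.
pose z m j w := error_term (fun i => Defs.eta ip phi Cj X j i%:Z w) (rhoj j) m.
pose V n w := \sum_(j < k n) (rhoj j - rho_hat ip phi X n j w) ^+ 2.
have mV n : measurable_fun setT (V n).
  apply: measurable_sum => j; apply: measurable_funX; apply: measurable_funB => //.
  exact: (measurable_rho_hat norm_ip arh1 A1).
have t_ge0 n : 0 <= t n.
  by rewrite -lee_fin -tE nneseries_ge0// => *; rewrite lee_fin sqr_ge0.
have setE n : [set w | (delta%:E < `|hs_norm e
      (fun y => (rho y - rho_hat_op ip phi X k n w y)%R)|)%E] =
    [set w | delta ^+ 2 - t (k n) < V n w].
  have Vt w : 0 <= V n w + t (k n).
    by apply: addr_ge0 => //; apply: sumr_ge0 => *; exact: sqr_ge0.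
  apply/funext => w; rewrite /= (hs_norm_error norm_ip basis_e X k (autocov_orthonormal A1)
    (autocorr_diagonal A2) n w tE)/= lte_fin ger0_norm ?sqrtr_ge0//.
  by rewrite -ltr_sqr ?nnegrE ?sqrtr_ge0 ?(ltW delta0)// sqr_sqrtr ?Vt// ltrBlDr.
have mS n : measurable [set w | delta ^+ 2 - t (k n) < V n w].
  rewrite [X in measurable X](_ : _ = setT `&` V n @^-1` `]delta ^+ 2 - t (k n), +oo[).
    by apply: mV => //; exact: measurable_itv.
  by apply/seteqP; split => w /=; rewrite in_itv/= ?andbT => // -[].
have lim0 : (fun n => (c^-1 * (W * ((k n)%:R / (n.-1)%:R)))%:E) @ \oo --> 0%:E.
  have h : (fun n => c^-1 * (W * ((k n)%:R / (n.-1)%:R))) @ \oo --> c^-1 * (W * 0).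
    apply: cvgM; first exact: cvg_cst.
    apply: cvgM; first exact: cvg_cst.
    exact: (truncation_sublinear (autocov_nonincreasing A1) (autocov_gt0 A1)
      (autocov_summable A1) k_bounds A3).
  by rewrite !mulr0 in h; apply: cvg_EFin h; exact: nearW.
apply: (squeeze_cvge _ (cvg_cst 0%:E) lim0).
(* Half of [delta ^ 2] is granted to the truncation bias, the other half to the estimated
   coordinates. *)
have tk : \forall n \near \oo, t (k n) <= delta ^+ 2 / 2.
  have : (t \o k) @ \oo --> 0 by apply: cvg_comp t0.
  move=> /cvgr0Pnorm_le /(_ (delta ^+ 2 / 2)) h.
  have /h : 0 < delta ^+ 2 / 2 by rewrite divr_gt0// exprn_gt0.
  by apply: filterS => n; apply: le_trans; exact: ler_norm.
have := nbhs_infty_ge 2; apply: filterS2 tk => n tk n2.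
rewrite measure_ge0/= setE.
have nE : n = n.-1.+1 by lia.
have m0 : (0 < n.-1)%N by lia.
pose Z w := \sum_(j < k n) z n.-1 j w.
have zmom j := error_term_moment norm_ip arh1 A1 A2 fourth_moment m0 (moment_variance A4 j).
have iz j : P.-integrable setT (EFin \o z n.-1 j) by have [] := zmom j.
have Ez j : Rintegral P setT (z n.-1 j) <= W / (n.-1)%:R.
  have [_ h] := zmom j; apply: le_trans h _; rewrite ler_pM2r ?invr_gt0 ?ltr0n//.
  by rewrite lerD2r ler_pM2l.
have iZ : P.-integrable setT (EFin \o Z).
  by apply: (@integrable_ord_sum _ _ _ _ (k n) (fun j => z n.-1 j)).
have z_ge0 j w : 0 <= z n.-1 j w by exact: error_term_ge0.
have Z_ge0 w : 0 <= Z w by apply: sumr_ge0.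
have mZ : measurable_fun setT Z by apply/measurable_EFinP; exact: measurable_int iZ.
have EZ : Rintegral P setT Z <= W * ((k n)%:R / (n.-1)%:R).
  rewrite (@mean_sum _ _ _ _ (k n) (fun j => z n.-1 j))//.
  apply: (@le_trans _ _ (\sum_(j < k n) W / (n.-1)%:R)); first exact: ler_sum.
  rewrite sumr_const card_ord -[X in X <= _]mulr_natr.
  by rewrite le_eqVlt; apply/orP; left; apply/eqP; ring.
apply: (@le_trans _ _ (P [set w | (c <= Z w)%R])).
  apply: le_measure; rewrite ?inE//.
    rewrite [X in measurable X](_ : _ = setT `&` Z @^-1` `[c, +oo[).
      by apply: mZ => //; exact: measurable_itv.
    by apply/seteqP; split => w /=; rewrite in_itv/= ?andbT => // -[].
  (* By contradiction: [Z w < c] would give [V n w < delta ^ 2 / 2], while [Vw] and [tk] force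
     [V n w > delta ^ 2 / 2]. *)
  move=> w /= Vw; rewrite leNgt; apply/negP => Zc.
  have Zs : Z w < (s / 8) ^+ 2 by apply: lt_le_trans Zc _; rewrite ge_min lexx.
  have Zd : Z w < delta ^+ 2 / 64 by apply: lt_le_trans Zc _; rewrite ge_min lexx orbT.
  have VZ : V n w <= 32 * Z w.
    rewrite /V /Z mulr_sumr; apply: ler_sum => j _.
    (* Each error term is at most their sum [Z], so one event on [Z] controls all [j < k n] at
       once. *)
    have zs : z n.-1 j w <= (s / 8) ^+ 2.
      apply: le_trans (ltW Zs); rewrite /Z (bigD1 j)//= lerDl.
      by apply: sumr_ge0.
    by have := rho_hat_error A1 m0 s0 (sr j) zs; rewrite -nE.
  by lra.
apply: le_trans (markov_ge0 c0 mZ iZ Z_ge0) _.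
by rewrite lee_fin ler_pM2l// invr_gt0.
Qed.
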